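(* Let $\mathbb{P}$ be the law of $Y=(A,X)$ on $[0,T]$, where $X$ is a continuous stochastic process (with values in $\mathbb{R}^{\mathcal{A}''}$) and $A$ is a deterministic (continuous) path of bounded variation (with values in $\mathbb{R}^{\mathcal{A}'}$). Suppose that the correlators $$\widehat{\mathcal{C}}^{[w]}_{0,T}(t_1,\dots,t_k)=\mathbb{E}_{Y\sim\mathbb{P}}\Big[\prod_{j=1}^{k+1}\frac{1}{[w_{j-1}]!}X_{0,t_j}^{[w_{j-1}]}\Big],\qquad t_{k+1}=T,\quad w_0,\dots,w_k\in\mathcal{W}_{\mathcal{A}''},$$ are finite and continuous. Then, for every word $w=w_0i_1w_1\cdots i_kw_k\in\mathcal{W}_{\mathcal{A}}$ (with $w_0,\dots,w_k\in\mathcal{W}_{\mathcal{A}''}$, $i_1,\dots,i_k\in\mathcal{A}'$), $$\big\langle[w_0]i_1[w_1]\cdots i_k[w_k],\ \widehat\Psi(\widehat{\boldsymbol\mu}^{\mathbb{P}})\big\rangle=\int_{0<t_1<\cdots<t_k<T}\widehat{\mathcal{C}}^{[w]}_{0,T}(t_1,\dots,t_k)\,\mathrm{d}A^{i_1}_{t_1}\cdots\mathrm{d}A^{i_k}_{t_k},$$ where $\widehat{\boldsymbol\mu}^{\mathbb{P}}=\mathbb{E}_{Y\sim\mathbb{P}}[\widehat{\mathrm{Sig}}(Y)_{0,T}]\in T_{\mathcal{A}''}((\mathbb{R}^d))$.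
   Context: $\mathcal{A}$ is an alphabet with $d$ letters, partitioned as $\mathcal{A}=\mathcal{A}'\,\dot\cup\,\mathcal{A}''$ (both nonempty); $\mathcal{W}_{\mathcal{B}}$ is the set of words over $\mathcal{B}$ including $\emptyset$. $\mathbb{R}\langle\mathcal{A}\rangle$ is the free associative algebra, with shuffle product $\sqcup\!\sqcup$ (bilinear, $w\sqcup\!\sqcup\emptyset=\emptyset\sqcup\!\sqcup w=w$, $wi\sqcup\!\sqcup vj=(w\sqcup\!\sqcup vj)i+(wi\sqcup\!\sqcup v)j$). $[\cdot]$ is the quotient map of $\mathbb{R}\langle\mathcal{A}\rangle$ by the two-sided ideal generated by $\{ij-ji:i,j\in\mathcal{A}''\}$; $[w]=[w_0]i_1[w_1]\cdots i_k[w_k]$. $T((\mathbb{R}^d))=\prod_n(\mathbb{R}^d)^{\otimes n}$ has basis elements $e_w$, $\langle w,e_v\rangle=\mathbf 1_{w=v}$; $T_{\mathcal{A}''}((\mathbb{R}^d))=\prod_{n\ge0}\mathrm{span}\{e_{[w]}:|w|=n\}$ with $\langle[w],e_{[v]}\rangle=\mathbf 1_{[w]=[v]}$, and $\mathbf a\mapsto\widehat{\mathbf a}$ is the linear quotient map with $\widehat{e_w}=e_{[w]}$, i.e. $\langle[w],\widehat{\mathbf a}\rangle=\sum_{v:[v]=[w]}\langle v,\mathbf a\rangle$. $\Psi$ on $T((\mathbb{R}^d))$ is $\Psi(\mathbf a)=\sum_we_w\langle\Psi_w,\mathbf a\rangle$ with $\Psi_w=w$ for $w\in\mathcal{W}_{\mathcal{A}''}$,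 and $\Psi_w=((\Psi_{w_0i_1\cdots i_{k-1}w_{k-1}})i_k)\sqcup\!\sqcup w_k$ for $w=w_0i_1w_1\cdots i_kw_k$, $k\ge1$. $\widehat\Psi$ is the induced graded linear automorphism of $T_{\mathcal{A}''}((\mathbb{R}^d))$, $\widehat\Psi(\widehat{\mathbf a})=\widehat{\Psi(\mathbf a)}$. For $v\in\mathcal{W}_{\mathcal{A}''}$ with letter multiplicities $(\alpha_i)_{i\in\mathcal{A}''}$: $X_{s,t}^{[v]}=\prod_i(X^i_t-X^i_s)^{\alpha_i}$, $[v]!=\prod_i\alpha_i!$. For continuous $X$ and continuous bounded-variation $A$, $\widehat{\mathrm{Sig}}(A,X)_{s,t}\in T_{\mathcal{A}''}((\mathbb{R}^d))$ is defined by requiring for all words $w=w_0i_1w_1\cdots i_kw_k$ $$\langle[w],\widehat\Psi(\widehat{\mathrm{Sig}}(A,X)_{s,t})\rangle=\frac{X_{s,t}^{[w_k]}}{[w_k]!}\int_{s<t_1<\cdots<t_k<t}\prod_{j=1}^k\frac{X_{s,t_j}^{[w_{j-1}]}}{[w_{j-1}]!}\,\mathrm{d}A^{i_j}_{t_j}$$ (Riemann–Stieltjes integrals). Expectations are coordinatewise. *)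

(* Defs.v *)
(* monalg has to be imported before MathComp-Analysis: the opposite order is
   rejected because of a clash of notation levels. *)
From HB Require Import structures.
From mathcomp Require Import all_boot all_order all_algebra.
From mathcomp Require Import generic_quotient finmap monalg.
From mathcomp Require Import all_classical all_reals all_analysis.

Set Implicit Arguments.
Unset Strict Implicit.
Unset Printing Implicit Defensive.

Import Order.TTheory GRing.Theory Num.Theory.
Import numFieldNormedType.Exports.
Local Open Scope classical_set_scope.
Local Open Scope ring_scope.

(* The alphabet is the disjoint union A' + A'': [inl i] is the letter i of A',
   [inr j] the letter j of A''. *)
Notation word A' A'' := (seq (A' + A'')%type).

Section FreeAlgebra.
Variables (R : realType) (A' A'' : finType).

(* R<A>: the monoid algebra of the free monoid {fmonom A} of words *)
Definition freeAlg := {malg R[{fmonom (A' + A'')%type}]}.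

Definition mono (w : word A' A'') : freeAlg := << FMonom w >>.
Definition letter (x : A' + A'') : freeAlg := mono [:: x].

(* Shuffle product of the *reversals* of two words: the recursion
   wi sh vj = (w sh vj) i + (wi sh v) j consumes words from the right. *)
Fixpoint shuffle_rev (w : word A' A'') : word A' A'' -> freeAlg :=
  if w is i :: w' then
    fix shuffle_rev_w (v : word A' A'') : freeAlg :=
      if v is j :: v' then
        shuffle_rev w' (j :: v') * letter i + shuffle_rev_w v' * letter j
      else mono (rev (i :: w'))
  else fun v => mono (rev v).

Definition shuffle_word (w v : word A' A'') : freeAlg :=
  shuffle_rev (rev w) (rev v).

Definition shuffle (p q : freeAlg) : freeAlg :=
  \sum_(w <- msupp p) \sum_(v <- msupp q)
    (p@_w * q@_v) *: shuffle_word w v.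

(* the two-sided ideal generated by the ij - ji, i, j \in A'' *)
Definition comm_ideal : set freeAlg := [set x |
  exists r : seq (freeAlg * (A'' * A'') * freeAlg),
    x = \sum_(c <- r)
      c.1.1 * (letter (inr c.1.2.1) * letter (inr c.1.2.2)
             - letter (inr c.1.2.2) * letter (inr c.1.2.1)) * c.2].

Lemma comm_ideal0 : comm_ideal 0.
Proof. by exists [::]; rewrite big_nil. Qed.

Lemma comm_idealD x y : comm_ideal x -> comm_ideal y -> comm_ideal (x + y).
Proof. by move=> [r ->] [s ->]; exists (r ++ s); rewrite big_cat. Qed.

Lemma comm_idealN x : comm_ideal x -> comm_ideal (- x).
Proof.
move=> [r ->]; exists [seq (- c.1.1, c.1.2, c.2) | c <- r].
by rewrite big_map -sumrN; apply: eq_bigr => c _ /=; rewrite !mulNr.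
Qed.

(* [w] = [v] in the quotient of R<A> by the ideal *)
Definition pceq (w v : word A' A'') : bool := `[< comm_ideal (mono w - mono v) >].

Lemma pceq_refl : reflexive pceq.
Proof. by move=> w; apply/asboolP; rewrite subrr; exact: comm_ideal0. Qed.

Lemma pceq_sym : symmetric pceq.
Proof.
by move=> w v; apply/asboolP/asboolP => /comm_idealN; rewrite opprB.
Qed.

Lemma pceq_trans : transitive pceq.
Proof.
move=> v w u /asboolP wv /asboolP vu; apply/asboolP.
by rewrite -(subrKA (mono v)); exact: comm_idealD.
Qed.

Canonical pceq_equiv := EquivRel pceq pceq_refl pceq_sym pceq_trans.

(* the set of all [w], w a word *)
Definition pcword := {eq_quot pceq}%qT.
Definition pcl (w : word A' A'') : pcword := (\pi_pcword w)%qT.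

(* T((R^d)) and T_{A''}((R^d)) are encoded by their coordinates:
   [a w] is <w, a> and [b [w]] is <[w], b>. *)
Definition tensor := word A' A'' -> R.
Definition pctensor := pcword -> R.
HB.instance Definition _ := Choice.copy pctensor (pcword -> R : choiceType).

Definition pairing (p : freeAlg) (a : tensor) : R :=
  \sum_(v <- msupp p) p@_v * a v.

(* a |-> \hat a.  The index set is finite, because [v] = [w] forces
   |v| = |w|. *)
Definition hat (a : tensor) : pctensor :=
  fun c => \sum_(v \in [set v | pcl v = c]) a v.

(* [Psi_rev r v] is Psi_w for w = rev r ++ v, where v is the part of the last
   A''-block of w read so far (from the right). *)
Fixpoint Psi_rev (r : word A' A'') (v : seq A'') : freeAlg :=
  match r with
  | [::] => mono (map inr v)
  | inr j :: r' => Psi_rev r' (j :: v)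
  | inl i :: r' =>
      shuffle (Psi_rev r' [::] * letter (inl i)) (mono (map inr v))
  end.

Definition Psi_word (w : word A' A'') : freeAlg := Psi_rev (rev w) [::].

Definition Psi (a : tensor) : tensor := fun w => pairing (Psi_word w) a.

(* the map induced by Psi on T_{A''}((R^d)); since hat is surjective, there is
   at most one F with this property *)
Definition hatPsi : pctensor -> pctensor :=
  @xget (pctensor -> pctensor : choiceType) id [set F | forall a, F (hat a) = hat (Psi a)].

(* w_0 i_1 w_1 ... i_k w_k *)
Definition block_word k (w : 'I_k.+1 -> seq A'') (i : 'I_k -> A') :
    word A' A'' :=
  flatten [seq rcons (map inr (w (lift ord_max j))) (inl (i j)) | j : 'I_k]
  ++ map inr (w ord_max).

End FreeAlgebra.

Section Integrals.
Variable R : realType.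

Definition is_RS_integral (a b : R) (f g : R -> R) (l : R) : Prop :=
  forall e, 0 < e -> exists2 d, 0 < d &
    forall (s : seq R) (xi : nat -> R), itv_partition a b s ->
      let p := nth b (a :: s) in
      (forall n, (n < size s)%N -> p n.+1 - p n < d) ->
      (forall n, (n < size s)%N -> p n <= xi n <= p n.+1) ->
      `| \sum_(0 <= n < size s) f (xi n) * (g (p n.+1) - g (p n)) - l | < e.

(* \int_a^b f dg *)
Definition RS_integral (a b : R) (f g : R -> R) : R :=
  xget 0 [set l | is_RS_integral a b f g l].

(* (t_1, ..., t_k), u |-> (t_1, ..., t_k, u) *)
Definition row_rcons k (t : 'rV[R]_k) (u : R) : 'rV[R]_k.+1 :=
  \row_j (if unlift ord_max j is Some j' then t 0 j' else u).

(* \int_{s < t_1 < ... < t_k < t} f(t_1, ..., t_k) dg^1_{t_1} ... dg^k_{t_k},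
   as an iterated integral with t_k as the outermost variable *)
Fixpoint simplex_integral (s t : R) k :
    ('rV[R]_k -> R) -> ('I_k -> R -> R) -> R :=
  if k is k'.+1 then fun f g =>
    RS_integral s t
      (fun u => simplex_integral s u (fun v => f (row_rcons v u))
                  (fun j => g (lift ord_max j)))
      (g ord_max)
  else fun f _ => f 0.

Definition closed_simplex (s t : R) k : set 'rV[R]_k :=
  [set u | (forall j, s <= u 0 j <= t) /\
           (forall i j : 'I_k, (i <= j)%N -> u 0 i <= u 0 j)].

End Integrals.

Section Signature.
Variables (R : realType) (A' A'' : finType).

(* X_{s,t}^{[v]} and [v]! *)
Definition incr_pow (x : A'' -> R -> R) (s t : R) (v : seq A'') : R :=
  \prod_i (x i t - x i s) ^+ count_mem i v.

Definition pcfact (v : seq A'') : nat := \prod_i (count_mem i v)`!.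

Definition is_hatSig (a : A' -> R -> R) (x : A'' -> R -> R) (s t : R)
    (S : pctensor R A' A'') : Prop :=
  forall k (w : 'I_k.+1 -> seq A'') (i : 'I_k -> A'),
    hatPsi S (pcl R (block_word w i)) =
    incr_pow x s t (w ord_max) / (pcfact (w ord_max))%:R *
    simplex_integral s t
      (fun u => \prod_j (incr_pow x s (u 0 j) (w (lift ord_max j))
                         / (pcfact (w (lift ord_max j)))%:R))
      (fun j => a (i j)).

Definition hatSig (a : A' -> R -> R) (x : A'' -> R -> R) (s t : R) :
    pctensor R A' A'' :=
  xget (fun=> 0) [set S | is_hatSig a x s t S].

End Signature.

Section Expectations.
Context {d : measure_display} {Omega : measurableType d} {R : realType}.
Variables (P : probability Omega R) (A' A'' : finType).
Implicit Type X : A'' -> R -> Omega -> R.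

(* the random variable under the expectation in \hat C^{[w]}_{0,T}(t);
   [row_rcons t T] encodes the convention t_{k+1} = T *)
Definition corr_rv X (T : R) k (w : 'I_k.+1 -> seq A'') (t : 'rV[R]_k)
    (omega : Omega) : R :=
  \prod_j (incr_pow (fun i u => X i u omega) 0 (row_rcons t T 0 j) (w j)
           / (pcfact (w j))%:R).

Definition correlator X (T : R) k (w : 'I_k.+1 -> seq A'') (t : 'rV[R]_k) : R :=
  fine ('E_P[corr_rv X T w t])%E.

Definition hatSig_rv X (a : A' -> R -> R) (T : R) (c : pcword R A' A'')
    (omega : Omega) : R :=
  hatSig a (fun i u => X i u omega) 0 T c.

Definition expected_hatSig X (a : A' -> R -> R) (T : R) : pctensor R A' A'' :=
  fun c => fine ('E_P[hatSig_rv X a T c])%E.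

End Expectations.

(* Main.v *)
Require Import Defs.
From HB Require Import structures.
From mathcomp Require Import all_boot all_order all_algebra.
From mathcomp Require Import generic_quotient finmap monalg.
From mathcomp Require Import all_classical all_reals all_analysis.
From mathcomp Require Import measurable_realfun ring lra.

Set Implicit Arguments.
Unset Strict Implicit.
Unset Printing Implicit Defensive.

Import Order.TTheory GRing.Theory Num.Theory.
Import numFieldNormedType.Exports.
Local Open Scope classical_set_scope.
Local Open Scope ring_scope.

(** The theorem exchanges an expectation with an iterated Riemann-Stieltjes
    integral, once the map induced by Psi on the partially commutative tensors
    has been inverted.

    Algebra.  [hatPsi] and [hatSig] are defined by choice among the maps or
    tensors with a given property, so one first shows that such objects exist.
    The polynomial Psi_w is a shuffle of w's own letters in which letters of A''
    move to the left; hence Psi_w = w + (words in which more pairs of a letter of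
    A'' before a letter of A' occur), see [Psi_coef_supp] and [Psi_coef_diag].
    The sum of the Psi_v over a class [w] has coefficients that are invariant
    under exchanging adjacent letters of A'' ([Psi_sum_swapinv]), because a
    shuffle of two invariant polynomials is invariant ([swapinv_shufcoef]).
    Invariant functions of words factor through the classes ([pcl_invariant]), so
    Psi descends to classes, where it is a unitriangular system of finitely many
    equations in each degree ([hatPsi_triangular]).  It can be solved for any
    right-hand side ([hatPsi_surj]), and properties of the solution that are
    preserved by finite linear combinations follow by induction along the
    triangular order ([cweight_ind]).

    Pathwise analysis.  Writing a continuous path of bounded variation as a
    difference of continuous nondecreasing functions, its Stieltjes measures
    provide the Riemann-Stieltjes integral of a continuous function as a function
    of the upper limit ([exists_primitive]); in particular it is again continuous
    ([RS_integral_ucont]).  The integrand of the iterated integral is a product of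
    functions of single variables, so it is computed by a recursion on the letters
    of the word ([word_integral_block]); the result depends only on the class of
    the word ([class_integral_pcl]).  Together with the surjectivity above this
    shows that the signature exists and gives its defining equation for every
    class ([hatPsi_hatSig]).

    Expectation.  The square of a correlator variable is a multiple of the
    correlator variable with every block doubled ([sqr_corr_rv]); the latter has a
    mean that is continuous on the compact simplex, so the correlator variables
    are bounded in mean square ([corr_rv_sq_bounded]).  A Riemann sum against a
    path of variation V multiplies such a bound by at most V^2, by the
    Cauchy-Schwarz inequality ([sq_bounded_sum]), and pointwise convergence with a
    mean-square bound implies convergence of means ([mean_cvg]).  Therefore the
    mean of a Riemann-Stieltjes integral is the integral of the means
    ([mean_RS_integral]).  Iterating over the variables, the outer ones being
    absorbed in a random factor Z, gives the formula for the iterated integral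
    ([mean_simplex_integral]).  The triangular system carries integrability and
    linearity over to the coordinates of the signature. *)

(** * Words, and the coefficients of shuffle products *)

Section Words.
Variable T : finType.

Fixpoint words n : seq (seq T) :=
  if n is n'.+1 then [seq x :: w | x <- enum T, w <- words n'] else [:: [::]].

Lemma mem_words n w : (w \in words n) = (size w == n).
Proof.
elim: n w => [|n IH] [|x w] //=.
  by apply/negbTE/negP => /allpairsP[[y v] /= [_ _]].
rewrite eqSS -IH; apply/allpairsP/idP => [[[y v] /= [_ vn [_ ->]]]//|wn].
by exists (x, w); rewrite mem_enum.
Qed.

Lemma uniq_words n : uniq (words n).
Proof.
elim: n => [|n IH] //=; apply: allpairs_uniq => //; first exact: enum_uniq.
by move=> [x v] [y w] _ _ /= [-> ->].
Qed.

Lemma big_words_cons (V : nmodType) n (F : seq T -> V) :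
  \sum_(w <- words n.+1) F w = \sum_x \sum_(w <- words n) F (x :: w).
Proof. by rewrite /= big_allpairs_dep big_enum. Qed.

(** The pairs of complementary subwords of u, with multiplicity: the coproduct
    dual to the shuffle product. *)
Fixpoint splits (u : seq T) : seq (seq T * seq T) :=
  if u is z :: u' then
    [seq (z :: p.1, p.2) | p <- splits u'] ++
    [seq (p.1, z :: p.2) | p <- splits u']
  else [:: ([::], [::])].

Lemma splits_perm u p : p \in splits u -> perm_eq u (p.1 ++ p.2).
Proof.
elim: u p => [|z u IH] p /=; first by rewrite inE => /eqP->.
rewrite mem_cat => /orP[] /mapP[q /IH uq ->] /=; first by rewrite perm_cons.
by rewrite perm_sym -cat1s perm_catCA /= perm_cons perm_sym.
Qed.

Variable R : pzRingType.

(** The coefficient at u of the linear combination of shuffles x sh y with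
    weights K x y.  Allowing an arbitrary K, and not only a product of two
    functions, lets one sum over words before shuffling. *)
Definition shufcoef (K : seq T -> seq T -> R) (u : seq T) : R :=
  \sum_(p <- splits u) K p.1 p.2.

Lemma shufcoef_nil K : shufcoef K [::] = K [::] [::].
Proof. by rewrite /shufcoef /= big_seq1. Qed.

Lemma shufcoef_cons K z u :
  shufcoef K (z :: u) =
  shufcoef (fun x y => K (z :: x) y) u + shufcoef (fun x y => K x (z :: y)) u.
Proof. by rewrite /shufcoef /= big_cat !big_map. Qed.

End Words.

Section Free.
Variables (R : realType) (A' A'' : finType).
Notation L := (A' + A'')%type.
Notation W := (word A' A'').
Implicit Types (u v w r : W) (b : seq A'').

(** Invariance under the relations that define the classes [w]. *)
Definition swapinv (V : Type) (h : W -> V) :=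
  forall u x y v, h (u ++ inr x :: inr y :: v) = h (u ++ inr y :: inr x :: v).

Lemma swapinv_rev (V : Type) (h : W -> V) : swapinv h -> swapinv (h \o rev).
Proof. by move=> hh u x y v; rewrite /= !rev_cat !rev_cons -!cats1 -!catA hh. Qed.

(** Exchange two adjacent letters of A'' in u and look at a splitting of u.  If
    both letters fall into the same part, the invariance of K in that variable
    applies; otherwise the exchange permutes the splittings.  Words are read from
    the first letter, so the induction peels off the letters before the pair. *)
Lemma swapinv_shufcoef (K : W -> W -> R) : (forall y, swapinv (K^~ y)) ->
  (forall x, swapinv (K x)) -> swapinv (shufcoef K).
Proof.
move=> K1 K2 u x y v; elim: u K K1 K2 => [|z u IH] K K1 K2 /=.
  rewrite !shufcoef_cons -!addrA; congr (_ + _).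
    by apply: eq_bigr => p _; exact: (K1 p.2 [::]).
  rewrite addrCA; congr (_ + (_ + _)).
  by apply: eq_bigr => p _; exact: (K2 p.1 [::]).
rewrite !shufcoef_cons; congr (_ + _); apply: IH.
- by move=> t u' *; exact: (K1 t (z :: u')).
- by move=> t u' *; exact: (K2 (z :: t) u').
- by move=> t u' *; exact: (K1 (z :: t) u').
- by move=> t u' *; exact: (K2 t (z :: u')).
Qed.

Definition coef (p : freeAlg R A' A'') w : R := p@_(FMonom w).

Lemma coef_mono w v : coef (mono R w) v = (w == v)%:R.
Proof. by rewrite /coef mcoeffU1 fmP. Qed.

Lemma coefD p q w : coef (p + q) w = coef p w + coef q w.
Proof. exact: mcoeffD. Qed.

Lemma coefZ a p w : coef (a *: p) w = a * coef p w.
Proof. exact: mcoeffZ. Qed.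

Lemma coef_sum (I : Type) (s : seq I) (P : pred I) (F : I -> freeAlg R A' A'') w :
  coef (\sum_(i <- s | P i) F i) w = \sum_(i <- s | P i) coef (F i) w.
Proof. by rewrite /coef raddf_sum. Qed.

(** Sums over the support of p may be taken over any list of words that contains
    it; this turns the pairing with a tensor into a sum over all words of one
    length. *)
Lemma sum_msupp (p : freeAlg R A' A'') (F : W -> R) (s : seq W) : uniq s ->
  (forall w, coef p w != 0 -> w \in s) ->
  \sum_(m <- msupp p) p@_m * F m = \sum_(w <- s) coef p w * F w.
Proof.
move=> us ps.
have -> : \sum_(w <- s) coef p w * F w =
    \sum_(m <- [seq FMonom w | w <- s]) p@_m * F m by rewrite big_map.
have um : uniq [seq FMonom w | w <- s] by rewrite map_inj_uniq// => x y [].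
rewrite [RHS](bigID (mem (msupp p)) predT) /= [X in _ = _ + X]big1 ?addr0; last first.
  by move=> m mp; rewrite mcoeff_outdom ?mul0r.
rewrite -[RHS]big_filter; apply: perm_big; apply: uniq_perm => //.
  exact: fset_uniq.
  exact: filter_uniq.
move=> m; rewrite mem_filter; apply/esym/andb_idr => mp.
by rewrite -(fmK m) map_f// ps// /coef fmK mcoeff_neq0.
Qed.

Lemma sum_msupp_delta (p : freeAlg R A' A'') (w : W) :
  \sum_(m <- msupp p) p@_m * (w == m)%:R = coef p w.
Proof.
have [p0|pn] := eqVneq (coef p w) 0.
  rewrite p0 big_seq big1// => m mp; case: eqP => [e|]; rewrite ?mulr0// mulr1.
  by rewrite -p0 /coef e fmK.
rewrite (big_rem (FMonom w)) /=; last by rewrite -mcoeff_neq0.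
rewrite eqxx mulr1 big_seq big1 ?addr0// => m.
rewrite mem_rem_uniq ?fset_uniq// inE => /andP[mw _].
case: eqP => [e|]; rewrite ?mulr0//.
by move: mw; rewrite e fmK eqxx.
Qed.

Lemma coef_mul_letter_nil p x : coef (p * letter R x) [::] = 0.
Proof.
rewrite /coef mcoeffMl big1// => m _; rewrite msuppU1 big_seq_fset1.
rewrite fmP fmM; case: eqP; rewrite ?mulr0//.
by case: m => [[|? ?]].
Qed.

Lemma coef_mul_letter p x u z :
  coef (p * letter R x) (rcons u z) = (z == x)%:R * coef p u.
Proof.
rewrite /coef mcoeffMl -/(coef p u) -sum_msupp_delta mulr_sumr; apply: eq_bigr => m _.
rewrite msuppU1 big_seq_fset1 fmP fmM mcoeffUU mulr1 cats1 eqseq_rcons.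
rewrite [z == x]eq_sym [u == _]eq_sym.
by case: (x == z); case: (_ == u); rewrite ?(mul1r, mul0r, mulr1, mulr0).
Qed.

Lemma coef_mul_letter_rev p x u : coef (p * letter R x) (rev u) =
  if u is z :: u' then (z == x)%:R * coef p (rev u') else 0.
Proof.
case: u => [|z u]; first exact: coef_mul_letter_nil.
by rewrite rev_cons coef_mul_letter.
Qed.

Lemma delta_cons (x y : L) (u v : W) :
  (x :: u == y :: v)%:R = (x == y)%:R * (u == v)%:R :> R.
Proof. by rewrite eqseq_cons -mulnb natrM. Qed.

Lemma shufcoefZ c (K : W -> W -> R) u :
  shufcoef (fun x y => c * K x y) u = c * shufcoef K u.
Proof. by rewrite /shufcoef mulr_sumr. Qed.

Lemma eq_shufcoef (K1 K2 : W -> W -> R) : K1 =2 K2 -> shufcoef K1 =1 shufcoef K2.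
Proof. by move=> K12 u; apply: eq_bigr => p _; rewrite K12. Qed.

Lemma shufcoef_nil_l v u :
  shufcoef (fun x y => (x == [::])%:R * (y == v)%:R) u = (u == v)%:R :> R.
Proof.
elim: u v => [|z u IH] v; first by rewrite shufcoef_nil mul1r.
rewrite shufcoef_cons [X in X + _]big1 ?add0r; last by move=> p _; rewrite mul0r.
case: v => [|j v]; first by rewrite /shufcoef big1 // => p _; rewrite mulr0.
rewrite delta_cons -IH -shufcoefZ; apply: eq_shufcoef => x y.
by rewrite delta_cons mulrCA.
Qed.

Lemma shufcoef_nil_r w u :
  shufcoef (fun x y => (x == w)%:R * (y == [::])%:R) u = (u == w)%:R :> R.
Proof.
elim: u w => [|z u IH] w; first by rewrite shufcoef_nil mulr1.
rewrite shufcoef_cons [X in _ + X]big1 ?addr0; last by move=> p _; rewrite mulr0.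
case: w => [|j w]; first by rewrite /shufcoef big1 // => p _; rewrite mul0r.
rewrite delta_cons -IH -shufcoefZ; apply: eq_shufcoef => x y.
by rewrite delta_cons mulrA.
Qed.

(** The step wi sh vj = (w sh vj) i + (wi sh v) j of the shuffle recursion, read
    on coefficients. *)
Lemma coef_two_letters p q x y u :
  coef (p * letter R x + q * letter R y) (rev u) =
  if u is z :: u' then (z == x)%:R * coef p (rev u') + (z == y)%:R * coef q (rev u')
  else 0.
Proof.
apply: etrans (coefD _ _ _) _.
apply: etrans (congr2 +%R (coef_mul_letter_rev p x u) (coef_mul_letter_rev q y u)) _.
by case: u => //; rewrite addr0.
Qed.

Lemma coef_shuffle_rev w v u :
  coef (shuffle_rev R w v) (rev u) = shufcoef (fun x y => (x == w)%:R * (y == v)%:R) u.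
Proof.
elim: w v u => [|i w IHw] v.
  have -> : shuffle_rev R [::] v = mono R (rev v) by case: v.
  by move=> u; rewrite coef_mono (inj_eq (can_inj revK)) shufcoef_nil_l eq_sym.
elim: v => [|j v IHv] u.
  by rewrite coef_mono (inj_eq (can_inj revK)) shufcoef_nil_r eq_sym.
apply: etrans (coef_two_letters (shuffle_rev R w (j :: v)) _ i j u) _.
case: u => [|z u]; first by rewrite shufcoef_nil mul0r.
rewrite IHw IHv shufcoef_cons -!shufcoefZ; congr (_ + _); apply: eq_shufcoef => x y.
  by rewrite (delta_cons z i) mulrA.
by rewrite (delta_cons z j) mulrCA.
Qed.

Lemma coef_shuffle_word w v u : coef (shuffle_word R w v) (rev u) =
  \sum_(t <- splits u) (rev t.1 == w)%:R * (rev t.2 == v)%:R.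
Proof.
rewrite /shuffle_word coef_shuffle_rev; apply: eq_bigr => t _.
by rewrite !(can2_eq revK revK).
Qed.

(** Words are reversed because the shuffle recursion consumes last letters while
    [splits] consumes first ones. *)
Lemma coef_shuffle p q u : coef (shuffle p q) (rev u) =
  shufcoef (fun x y => coef p (rev x) * coef q (rev y)) u.
Proof.
transitivity (\sum_(w <- msupp p) \sum_(v <- msupp q) \sum_(t <- splits u)
   (p@_w * (rev t.1 == w)%:R) * (q@_v * (rev t.2 == v)%:R)).
  rewrite /shuffle coef_sum; apply: eq_bigr => w _.
  rewrite coef_sum; apply: eq_bigr => v _.
  by rewrite coefZ coef_shuffle_word mulr_sumr; apply: eq_bigr => t _; rewrite mulrACA.
under eq_bigr => w _ do rewrite exchange_big.
rewrite exchange_big; apply: eq_bigr => t _ /=.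
under eq_bigr => w _ do rewrite -mulr_sumr sum_msupp_delta.
by rewrite -mulr_suml sum_msupp_delta.
Qed.

End Free.

(** * The polynomials Psi_w: symmetry and triangularity *)

Section Psi.
Variables (R : realType) (A' A'' : finType).
Notation L := (A' + A'')%type.
Notation W := (word A' A'').
Implicit Types (u v w r : W) (b : seq A'').

Definition isinr (x : L) : bool := if x is inr _ then true else false.

(** Here r is the reversed beginning of the word and b the part of its last block
    that has been read, so the reversed word is [map inr (rev b) ++ r]. *)
Definition Psi_coef r b u : R := coef (Psi_rev R r b) (rev u).

Definition cons_coef i r u : R :=
  if u is z :: u' then (z == inl i)%:R * Psi_coef r [::] u' else 0.

Lemma Psi_coef_nil b u : Psi_coef [::] b u = (u == map inr (rev b))%:R.
Proof. by rewrite /Psi_coef coef_mono map_rev -(can2_eq revK revK) eq_sym. Qed.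

Lemma Psi_coef_inr j r b u : Psi_coef (inr j :: r) b u = Psi_coef r (j :: b) u.
Proof. by []. Qed.

Lemma Psi_coef_inl i r b u :
  Psi_coef (inl i :: r) b u =
  shufcoef (fun x y => cons_coef i r x * (y == map inr (rev b))%:R) u.
Proof.
apply: etrans (coef_shuffle _ _ _) _; apply: eq_shufcoef => x y.
congr (_ * _); first exact: coef_mul_letter_rev.
by rewrite coef_mono map_rev -(can2_eq revK revK) eq_sym.
Qed.

(** [b |-> map inr (rev b)] is a bijection from the words of length m over A'' to
    the words of length m all of whose letters are in A''. *)
Lemma sum_delta_block m (y : W) :
  \sum_(b <- words A'' m) (y == map inr (rev b))%:R =
  (all isinr y && (size y == m))%:R :> R.
Proof.
have [ya|yna] := boolP (all isinr y); last first.
  rewrite big1// => b _; case: eqP => // e; case/negP: yna; rewrite e all_map.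
  by apply/allP.
have [b0 ->] : exists b0, y = map inr (rev b0).
  elim: y ya => [_|[i|j] y IH]; first by exists [::].
    by [].
  by move=> /= /IH[b ->]; exists (rcons b j); rewrite rev_rcons.
rewrite /= size_map size_rev -mem_words.
under eq_bigr => b _ do
  rewrite (inj_eq (inj_map (@inr_inj A' A''))) (inj_eq (can_inj revK)).
have [bm|bm] := boolP (b0 \in words A'' m).
  rewrite (big_rem b0)//= eqxx big_seq big1 ?addr0// => b.
  by rewrite mem_rem_uniq ?uniq_words// inE eq_sym => /andP[/negbTE->].
rewrite big_seq big1// => b bb; case: eqP => // e.
by move: bm; rewrite e bb.
Qed.

(** The polynomial of which this is the coefficient is the sum of h(w) Psi_w over
    the reversed words w that start with m letters of A'', followed by n arbitrary
    ones.  The block of m letters is the accumulator of the recursion for Psi. *)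
Definition Psi_sum n m (h : W -> R) u : R :=
  \sum_(b <- words A'' m) \sum_(r <- words L n) h (map inr (rev b) ++ r) * Psi_coef r b u.

(** For h the indicator of a class this says that the sum of Psi_v over the class
    is invariant.  Working with all invariant weights h makes the induction go
    through: once the last block y and the letter i before it are fixed, the rest
    of the word is weighted by h (y ++ inl i :: _), which is invariant again. *)
Lemma Psi_sum_swapinv n m h : swapinv h -> swapinv (Psi_sum n m h).
Proof.
elim: n m h => [|n IH] m h hh.
  have E u : Psi_sum 0 m h u = h u * (all isinr u && (size u == m))%:R.
    rewrite -sum_delta_block mulr_sumr; apply: eq_bigr => b _.
    rewrite big_seq1 Psi_coef_nil cats0; case: eqP => [->|]; by rewrite ?mulr0.
  by move=> u x y v; rewrite !E hh !all_cat !size_cat.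
have E u : Psi_sum n.+1 m h u = Psi_sum n m.+1 h u + \sum_i shufcoef (fun x y =>
   (all isinr y && (size y == m))%:R *
   \sum_(r <- words L n) h (y ++ inl i :: r) * cons_coef i r x) u.
  rewrite /Psi_sum.
  under eq_bigr => b _ do rewrite big_words_cons.
  rewrite exchange_big big_sumType /= addrC; congr (_ + _).
    rewrite -/(words _ m.+1) big_words_cons; apply: eq_bigr => j _; apply: eq_bigr => b _.
    apply: eq_bigr => r _.
    by rewrite Psi_coef_inr rev_cons map_rcons cat_rcons.
  apply: eq_bigr => i _.
  rewrite /shufcoef.
  under eq_bigr => b _ do under eq_bigr => r _ do rewrite Psi_coef_inl /shufcoef mulr_sumr.
  under eq_bigr => b _ do rewrite exchange_big.
  rewrite exchange_big; apply: eq_bigr => -[x y] _ /=.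
  rewrite -sum_delta_block mulr_suml; apply: eq_bigr => b _.
  rewrite mulr_sumr; apply: eq_bigr => r _.
  case: eqP => [->|_]; first by rewrite mul1r mulr1.
  by rewrite !mulr0 mul0r.
move=> u x y v; rewrite !E; congr (_ + _); first exact: IH.
(* both variables of the shuffled combination: the rest of the word by the
   induction hypothesis, the last block because h is invariant *)
apply: eq_bigr => i _; apply: swapinv_shufcoef => [t|t] {u x y v} u x y v.
  congr (_ * _); case: u => [|z u] /=; first by rewrite !big1// => r _; rewrite mul0r mulr0.
  have F s : \sum_(r <- words L n)
       h (t ++ inl i :: r) * ((z == inl i)%:R * Psi_coef r [::] s) =
     (z == inl i)%:R * Psi_sum n 0 (fun s => h (t ++ inl i :: s)) s.
    by rewrite /Psi_sum big_seq1 mulr_sumr; apply: eq_bigr => r _; rewrite mulrCA.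
  rewrite !F; congr (_ * _); apply: IH => a c d e.
  have := hh (t ++ inl i :: a) c d e; by rewrite -!catA.
rewrite !all_cat !size_cat /=; congr (_ * _); apply: eq_bigr => r _; congr (_ * _).
by rewrite -!catA /= hh.
Qed.

(** The number of pairs of a letter of A' and a later letter of A'', in the
    reversed word. *)
Definition weight := fix weight u : nat :=
  if u is x :: u' then ((if x is inl _ then count isinr u' else 0) + weight u')%N else 0%N.

Lemma weight_swapinv : swapinv weight.
Proof.
move=> u x y v; elim: u => [|z u IH] //=.
by rewrite IH !count_cat.
Qed.

Lemma weight_cat_inr u v : all isinr u -> weight (u ++ v) = weight v.
Proof. by elim: u => [|[i|j] u IH]//= /IH. Qed.

Lemma splits_weight u x y : (x, y) \in splits u -> all isinr y -> (weight x <= weight u)%N.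
Proof.
elim: u x y => [|z u IH] x y /=; first by rewrite inE => /eqP[-> _].
rewrite mem_cat => /orP[] /mapP[[x' y'] uxy [-> ->]] /= ya.
  apply: leq_add; last exact: IH uxy ya.
  case: z => // i; have /permP-> := splits_perm uxy.
  by rewrite count_cat leq_addr.
case: z ya => // j /= ya; exact: IH uxy ya.
Qed.

(** Inserting letters y of A'' into a reversed word that starts with a letter of
    A' creates new pairs, unless all of y is put in front. *)
Lemma splits_weight_lt u i x y : (inl i :: x, y) \in splits u -> all isinr y ->
  u = y ++ inl i :: x \/ (weight (inl i :: x) < weight u)%N.
Proof.
elim: u y => [|z u IH] y //=.
rewrite mem_cat => /orP[] /mapP[[x' y'] uxy]; last first.
  case=> xx -> /= ya; rewrite -{}xx in uxy.
  case: z ya => // j /= ya; case: (IH _ uxy) => //.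
    by move=> ->; left.
  by move=> ?; right.
case=> <- -> -> /= ya.
case: y' uxy ya => [|a y'] uxy ya.
  (* no letter of A'' is left to insert *)
  left => /=; congr (_ :: _); move: uxy; elim: u x' {IH} => [|t u IH] x' /=.
    by rewrite inE => /eqP[->].
  by rewrite mem_cat => /orP[] /mapP[[x2 y2] uxy [-> // E]]; rewrite (IH x2)// E.
right; have /permP-> := splits_perm uxy.
rewrite count_cat -addnA ltn_add2l; move: ya => /=; case: a uxy => // a uxy /= ya.
rewrite ltnS; apply: leq_trans (splits_weight uxy ya) _.
by rewrite leq_addl.
Qed.

(** Triangularity: the words of Psi_w other than w itself have a larger weight. *)
Lemma Psi_coef_supp r b u : Psi_coef r b u != 0 ->
  let w := map inr (rev b) ++ r in perm_eq u w /\ (u = w \/ (weight w < weight u)%N).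
Proof.
elim: r b u => [|[i|j] r IH] b u /=.
- rewrite Psi_coef_nil cats0; case: (u =P _) => [->|]; last by rewrite eqxx.
  by split => //; left.
- rewrite Psi_coef_inl /shufcoef => /eqP H.
  have [[x y] xy /= nz] : exists2 p, p \in splits u &
      cons_coef i r p.1 * (p.2 == map inr (rev b))%:R != 0.
    apply/not_exists2P => K; apply: H; rewrite big_seq big1// => p /[dup] up.
    by case: (K p) => // /negP/negPn/eqP.
  move: nz; case: (y =P _) => [yb|]; last by rewrite mulr0 eqxx.
  rewrite mulr1 => {H}; case: x xy => [|z x] xy /=; first by rewrite eqxx.
  case: (z =P _) => [zi|]; last by rewrite mul0r eqxx.
  rewrite mul1r => /IH /= [xr wx]; subst z.
  have ya : all isinr y by rewrite yb all_map; apply/allP.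
  rewrite -yb; split.
    rewrite (permPl (splits_perm xy)) perm_catC perm_cat2l perm_cons//.
  have wr : (weight (inl i :: r) <= weight (inl i :: x))%N.
    rewrite /= (permP xr) leq_add2l.
    by case: wx => [->//|/ltnW].
  rewrite weight_cat_inr//; case: (splits_weight_lt xy ya) => [->|]; last first.
    by move=> H; right; exact: leq_ltn_trans H.
  case: wx => [->|wx]; [by left|right].
  by rewrite weight_cat_inr//= (permP xr) ltn_add2l.
- rewrite Psi_coef_inr => /IH /=.
  by rewrite rev_cons map_rcons cat_rcons.
Qed.

Lemma count_splits_nil u : count_mem (u, [::]) (splits u) = 1%N.
Proof.
elim: u => [|z u IH] //=; rewrite count_cat !count_map.
rewrite [X in (_ + X)%N](@eq_count _ _ pred0) ?count_pred0 ?addn0; last first.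
  by case=> x y /=; apply/negbTE/negP => /eqP[].
rewrite -[RHS]IH; apply: eq_count => -[x y] /=.
by rewrite !xpair_eqE eqseq_cons eqxx.
Qed.

Lemma count_splits_block i r (y : W) : all isinr y ->
  count_mem (inl i :: r, y) (splits (y ++ inl i :: r)) = 1%N.
Proof.
elim: y => [_|[//|j] y IH ya]; first exact: count_splits_nil.
rewrite /= count_cat !count_map.
rewrite [X in (X + _)%N](@eq_count _ _ pred0) ?count_pred0 ?add0n; last first.
  by case=> x1 y1 /=; apply/negbTE/negP => /eqP[].
rewrite -[RHS]IH//; apply: eq_count => -[x1 y1] /=.
by rewrite !xpair_eqE eqseq_cons eqxx.
Qed.

(** By the weights, w arises in the shuffle only from the leading word of the
    first factor and from the splitting that cuts off the whole last block, and
    there is one such splitting. *)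
Lemma Psi_coef_diag r b : Psi_coef r b (map inr (rev b) ++ r) = 1.
Proof.
elim: r b => [|[i|j] r IH] b.
- by rewrite Psi_coef_nil cats0 eqxx.
- rewrite Psi_coef_inl /shufcoef; set y := map inr (rev b).
  have ya : all isinr y by rewrite /y all_map; apply/allP.
  rewrite (eq_big_seq (fun p => (p == (inl i :: r, y))%:R)).
    rewrite -[RHS]/(1%:R) -(count_splits_block i r ya) -sum1_count natr_sum.
    by rewrite [RHS]big_mkcond; apply: eq_bigr => p _ /=; case: eqP.
  move=> [x y'] xy /=; rewrite xpair_eqE -mulnb natrM.
  case: (y' =P y) => [yb|]; rewrite ?mulr0// !mulr1.
  case: x xy => [|z x] xy //=.
  rewrite eqseq_cons -mulnb natrM.
  case: (z =P _) => [zi|]; rewrite ?mul0r// !mul1r.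
  case: (x =P r) => [->|xr]; first exact: (IH [::]).
  apply/eqP/negPn/negP => /Psi_coef_supp /= [pr [//|wxr]].
  have := splits_weight xy; rewrite yb zi weight_cat_inr// => /(_ ya) /=.
  by rewrite (permP pr) leq_add2l leqNgt wxr.
- by rewrite Psi_coef_inr -(IH (j :: b)) rev_cons map_rcons cat_rcons.
Qed.

End Psi.

(** * Passing to classes of words: the map induced by Psi *)

Section Quotient.
Variables (R : realType) (A' A'' : finType).
Notation L := (A' + A'')%type.
Notation W := (word A' A'').
Notation pcl := (@pcl R A' A'').
Notation pcword := (pcword R A' A'').
Implicit Types (u v w r : W) (b : pctensor R A' A'') (c : pcword) (a : tensor R A' A'').

Lemma mono_cat u v : mono R (u ++ v) = mono R u * mono R v.
Proof.
rewrite /mono malgM_def fgmulUU mulr1; congr (<< _ *g _ >>).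
by apply/eqP; rewrite fmP fmM.
Qed.

Lemma mono_split u x y v :
  mono R (u ++ x :: y :: v) = mono R u * (letter R x * letter R y) * mono R v.
Proof.
rewrite -[x :: y :: v]/(([:: x] ++ [:: y]) ++ v) catA.
by rewrite mono_cat mono_cat (mono_cat [:: x]).
Qed.

Lemma pclP u v : reflect (comm_ideal (mono R u - mono R v)) (pcl u == pcl v).
Proof.
apply: (iffP eqP) => [/eqmodP/asboolP//|H].
by apply/eqmodP/asboolP.
Qed.

Lemma pcl_swapinv : swapinv pcl.
Proof.
move=> u x y v; apply/eqP/pclP.
exists [:: (mono R u, (x, y), mono R v)]; rewrite big_seq1 /=.
by rewrite (mono_split u (inr x)) (mono_split u (inr y)) mulrBr mulrBl.
Qed.

(** An invariant function of words extends linearly to a functional that kills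
    the ideal; it suffices to test it on a monomial times a commutator of letters
    times a monomial. *)
Section Functional.
Variable h : W -> R.
Notation F := (mmap (@idfun R) (fun m : {fmonom L} => h m)).

Lemma functional_mull (p q : freeAlg R A' A'') :
  (forall (e : R) (m : {fmonom L}), F (<< e *g m >> * q) = 0) -> F (p * q) = 0.
Proof.
move=> H; rewrite malgM_def fgmulEl1 raddf_sum big1// => m _.
by rewrite -malgM_def; exact: H.
Qed.

Lemma functional_mulr (p q : freeAlg R A' A'') :
  (forall (e : R) (m : {fmonom L}), F (p * << e *g m >>) = 0) -> F (p * q) = 0.
Proof.
move=> H; rewrite malgM_def fgmulEr1 raddf_sum big1// => m _.
by rewrite -malgM_def; exact: H.
Qed.

Lemma functional_letters (e f : R) (m n : {fmonom L}) x y :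
  F (<< e *g m >> * (letter R x * letter R y * << f *g n >>)) =
  e * f * h (m ++ x :: y :: n).
Proof.
rewrite /letter /mono malgM_def malgM_def malgM_def fgmulUU fgmulUU fgmulUU mmapU.
by rewrite fmM fmM fmM mulr1 mul1r.
Qed.

Lemma functional_sub (p q x y : freeAlg R A' A'') : F (p * (x * q)) = F (p * (y * q)) ->
  F (p * ((x - y) * q)) = 0.
Proof.
move=> E; rewrite mulrBl mulrBr raddfB; apply/eqP; rewrite subr_eq0; apply/eqP.
exact: E.
Qed.

Lemma comm_ideal_functional (x : freeAlg R A' A'') :
  swapinv h -> comm_ideal x -> F x = 0.
Proof.
move=> hh [r ->]; rewrite raddf_sum big1// => -[[p [i j]] q] _ /=.
apply: functional_mulr => f n; rewrite -mulrA; apply: functional_mull => e m.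
apply: functional_sub.
apply: etrans (functional_letters _ _ _ _ _ _) _.
exact: etrans (congr1 (fun t => e * f * t) (hh _ _ _ _))
  (esym (functional_letters _ _ _ _ _ _)).
Qed.

End Functional.

(** Two words with the same class cannot be separated by an invariant function:
    apply the functional given by the indicator of a fibre of h. *)
Lemma pcl_invariant (V : Type) (h : W -> V) u v : swapinv h -> pcl u = pcl v -> h u = h v.
Proof.
move=> hh /eqP/pclP uv.
pose h' w : R := (`[< h w = h v >])%:R.
have hh' : swapinv h' by move=> p x y q; rewrite /h' hh.
have := comm_ideal_functional hh' uv.
rewrite raddfB /= /mono !mmapU /h' /= !mul1r => /eqP; rewrite subr_eq0.
by rewrite eqr_nat (asboolT (erefl (h v))) eqb1 => /asboolP.
Qed.

Lemma pcl_repr c : pcl (repr c) = c.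
Proof. exact: reprK. Qed.

Definition csize c := size (repr c).
Definition cweight c := weight (rev (repr c)).

Lemma csize_pcl u : csize (pcl u) = size u.
Proof.
apply: (pcl_invariant (h := size)); last exact: pcl_repr.
by move=> p x y q; rewrite !size_cat.
Qed.

Lemma cweight_pcl u : cweight (pcl u) = weight (rev u).
Proof.
apply: (pcl_invariant (h := @weight A' A'' \o rev)); last exact: pcl_repr.
exact/swapinv_rev/weight_swapinv.
Qed.

Lemma hat_sum a c : hat a c = \sum_(v <- words L (csize c) | pcl v == c) a v.
Proof.
rewrite /hat (fsbigE [seq v <- words L (csize c) | pcl v == c]).
- rewrite big_filter_cond; apply: eq_bigl => v.
  by apply: andb_idr => /eqP vc; rewrite inE.
- exact/filter_uniq/uniq_words.
- by move=> v /=; rewrite mem_filter => /andP[/eqP].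
- by move=> v /= <-; rewrite mem_filter eqxx mem_words csize_pcl eqxx.
Qed.

(** The matrix of [hatPsi]: the column index is a class, given by any of the words
    u in it. *)
Definition hatPsi_coef c u : R :=
  \sum_(v <- words L (csize c) | pcl v == c) coef (Psi_word R v) u.

Lemma Psi_word_coef w u : coef (Psi_word R w) u = Psi_coef R (rev w) [::] (rev u).
Proof. by rewrite /Psi_coef revK. Qed.

Lemma Psi_word_supp w u : coef (Psi_word R w) u != 0 ->
  perm_eq u w /\ (u = w \/ (weight (rev w) < weight (rev u))%N).
Proof.
rewrite Psi_word_coef => /Psi_coef_supp /= [uw H]; split.
  by move: uw; rewrite perm_rev perm_sym perm_rev perm_sym.
by case: H => [/(can_inj revK)|]; [left|right].
Qed.

Lemma hatPsi_coef_swapinv c : swapinv (hatPsi_coef c).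
Proof.
have E u : hatPsi_coef c u = Psi_sum (csize c) 0 (fun r => (pcl (rev r) == c)%:R) (rev u).
  rewrite /hatPsi_coef /Psi_sum big_seq1 big_mkcond /=.
  have pw : perm_eq (words L (csize c)) (map rev (words L (csize c))).
    apply: uniq_perm; rewrite ?map_inj_uniq ?uniq_words//; first exact: (can_inj revK).
    move=> v; rewrite -{2}(revK v) mem_map; last exact: (can_inj revK).
    by rewrite !mem_words size_rev.
  rewrite [RHS](perm_big _ pw) big_map; apply: eq_bigr => v _.
  by rewrite Psi_word_coef revK; case: eqP; rewrite ?mul1r ?mul0r.
move=> u x y v; rewrite !E; apply: (swapinv_rev (h := Psi_sum _ _ _)).
apply: Psi_sum_swapinv => p s t q; congr (_ == _)%:R.
exact: (swapinv_rev pcl_swapinv).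
Qed.

Lemma hatPsi_coef_supp c u : hatPsi_coef c u != 0 ->
  pcl u = c \/ (cweight c < weight (rev u))%N.
Proof.
move=> /eqP H.
have [v /eqP vc nz] : exists2 v, pcl v == c & coef (Psi_word R v) u != 0.
  apply/not_exists2P => K; apply: H; rewrite /hatPsi_coef big1// => v vc.
  by case: (K v) => // /negP/negPn/eqP.
have [_ [->|lt]] := Psi_word_supp nz; [by left|right].
by rewrite -vc cweight_pcl.
Qed.

Lemma hatPsi_coef_diag c u : pcl u = c -> hatPsi_coef c u = 1.
Proof.
move=> uc; rewrite /hatPsi_coef (big_rem u) /=; last by rewrite mem_words -uc csize_pcl.
rewrite uc eqxx big_seq_cond big1 ?addr0.
  by rewrite Psi_word_coef; exact: (Psi_coef_diag R (rev u) [::]).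
move=> v; rewrite mem_rem_uniq ?uniq_words// inE => /andP[/andP[vu _] /eqP vc].
apply/eqP/negPn/negP => /Psi_word_supp[_ [uv|]].
  by rewrite uv eqxx in vu.
by rewrite -!cweight_pcl uc vc ltnn.
Qed.

Lemma hat_Psi_sum a c : hat (Psi a) c = \sum_(u <- words L (csize c)) hatPsi_coef c u * a u.
Proof.
rewrite hat_sum /hatPsi_coef.
under [RHS]eq_bigr => u _ do rewrite mulr_suml.
rewrite exchange_big; apply: eq_bigr => v /eqP vc.
rewrite /Psi /pairing (@sum_msupp _ _ _ _ _ (words L (csize c)))//; first exact: uniq_words.
move=> u /Psi_word_supp[uv _]; rewrite mem_words (perm_size uv).
by rewrite -vc csize_pcl.
Qed.

(** One word is selected in each class, to index sums over classes. *)
Definition canonical_word u := u == repr (pcl u).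

Lemma sum_classes n (m : W -> R) a : swapinv m ->
  \sum_(u <- words L n) m u * a u =
  \sum_(u <- words L n | canonical_word u) m u * hat a (pcl u).
Proof.
move=> mm.
transitivity (\sum_(u <- words L n | canonical_word u)
    \sum_(v <- words L n | pcl v == pcl u) m u * a v); last first.
  rewrite big_seq_cond [RHS]big_seq_cond; apply: eq_bigr => u.
  by rewrite mem_words => /andP[/eqP un _]; rewrite hat_sum csize_pcl un mulr_sumr.
rewrite [RHS]big_mkcond /=.
under [RHS]eq_bigr => u _ do rewrite big_mkcond /=.
transitivity (\sum_(v <- words L n) \sum_(u <- words L n)
    if canonical_word u && (pcl v == pcl u) then m u * a v else 0); last first.
  rewrite exchange_big; apply: eq_bigr => u _ /=.
  by case: (canonical_word u) => //; rewrite big1.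
rewrite big_seq [RHS]big_seq; apply: eq_bigr => v; rewrite mem_words => vn.
rewrite (big_rem (repr (pcl v))) /=; last by rewrite mem_words -/(csize _) csize_pcl.
rewrite /canonical_word pcl_repr !eqxx /= (pcl_invariant mm (pcl_repr (pcl v))).
rewrite big_seq big1 ?addr0// => u; rewrite mem_rem_uniq ?uniq_words// inE => /andP[ur _].
by case: ifP => // /andP[/eqP uu /eqP vu]; move: ur; rewrite vu -uu eqxx.
Qed.

Definition canonical_lift b : tensor R A' A'' :=
  fun u => if canonical_word u then b (pcl u) else 0.

Lemma canonical_liftK b : hat (canonical_lift b) = b.
Proof.
apply/funext => c; rewrite hat_sum (big_rem (repr c)) /=; last by rewrite mem_words.
rewrite pcl_repr eqxx /canonical_lift /canonical_word pcl_repr eqxx.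
rewrite big_seq_cond big1 ?addr0// => v; rewrite mem_rem_uniq ?uniq_words// inE.
move=> /andP[/andP[vc _] /eqP pvc]; rewrite pvc; case: eqP => // e.
by rewrite e eqxx in vc.
Qed.

(** The matrix of Psi has invariant coefficients, so hat (Psi a) is determined by
    hat a; this is the map that the definition of [hatPsi] asks for. *)
Lemma hatPsi_hat a : hatPsi (hat a) = hat (Psi a).
Proof.
rewrite /hatPsi; case: xgetP => [F _ -> //|].
move=> /(_ (fun b => hat (Psi (canonical_lift b)))) []; move=> {}a /=.
apply/funext => c; rewrite !hat_Psi_sum !sum_classes ?canonical_liftK//;
  exact: hatPsi_coef_swapinv.
Qed.

Lemma hatPsi_triangular b c : hatPsi b c = b c +
  \sum_(u <- words L (csize c) | canonical_word u && (cweight c < weight (rev u))%N)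
     hatPsi_coef c u * b (pcl u).
Proof.
rewrite -{1}(canonical_liftK b) hatPsi_hat hat_Psi_sum.
rewrite sum_classes ?canonical_liftK; last exact: hatPsi_coef_swapinv.
rewrite (bigID (fun u => cweight c < weight (rev u))%N) /= addrC; congr (_ + _).
rewrite (big_rem (repr c)) /=; last by rewrite mem_words.
rewrite /canonical_word pcl_repr eqxx /= -/(cweight c) ltnn /=.
rewrite hatPsi_coef_diag ?pcl_repr// mul1r.
rewrite big_seq_cond big1 ?addr0// => u; rewrite mem_rem_uniq ?uniq_words// inE.
move=> /andP[/andP[uc _] /andP[/eqP can nlt]].
have [->|/hatPsi_coef_supp[puc|]] := eqVneq (hatPsi_coef c u) 0; first by rewrite mul0r.
  by move: uc; rewrite can puc eqxx.
by rewrite (negbTE nlt).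
Qed.

Lemma cweight_le c : (cweight c <= csize c * csize c)%N.
Proof.
rewrite /cweight /csize -(size_rev (repr c)); elim: (rev _) => [|x u IH] //=.
rewrite mulSn mulnS addnA; apply: leq_add; last exact: IH.
case: x => // _; apply: leq_trans (count_size _ _) _.
by rewrite addSn leqW// leq_addr.
Qed.

(** Induction downwards on the weight, which is bounded in each degree. *)
Lemma cweight_ind (P : pcword -> Prop) :
  (forall c,
    (forall c', csize c' = csize c -> (cweight c < cweight c')%N -> P c') -> P c) ->
  forall c, P c.
Proof.
move=> H c; have [n] := ubnP (csize c * csize c - cweight c)%N.
elim: n c => // n IH c; rewrite ltnS => cn; apply: H => c' sc lt; apply: IH.
apply: leq_trans cn; rewrite sc; apply: ltn_sub2l => //.
by apply: leq_trans lt _; rewrite -sc; exact: cweight_le.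
Qed.

(** The system b = r - U b, with U strictly raising the weight, is solved by
    iteration: the coordinate at c no longer changes after more steps than there
    are weights above that of c. *)
Lemma hatPsi_surj (r : pctensor R A' A'') : exists b, hatPsi b = r.
Proof.
pose U b c : R := \sum_(u <- words L (csize c) |
    canonical_word u && (cweight c < weight (rev u))%N) hatPsi_coef c u * b (pcl u).
pose S m : pctensor R A' A'' := iter m (fun b c => r c - U b c) r.
have stable m m' c : (csize c * csize c - cweight c < m)%N ->
    (csize c * csize c - cweight c < m')%N -> S m c = S m' c.
  elim: m m' c => // m IH [//|m'] c; rewrite !ltnS => cm cm' /=.
  congr (_ - _); rewrite /U big_seq_cond [RHS]big_seq_cond; apply: eq_bigr => u.
  rewrite mem_words => /andP[/eqP un /andP[_ lt]]; congr (_ * _).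
  have lt' : (csize (pcl u) * csize (pcl u) - cweight (pcl u) <
      csize c * csize c - cweight c)%N.
    rewrite csize_pcl un cweight_pcl; apply: ltn_sub2l => //.
    by rewrite -un -csize_pcl; apply: leq_trans (cweight_le _); rewrite cweight_pcl.
  by apply: IH; [exact: leq_trans cm|exact: leq_trans cm'].
exists (fun c => S (csize c * csize c).+1 c); apply/funext => c.
have SE m : S m.+1 c = r c - U (S m) c by [].
set n := (csize c * csize c)%N.
have lt : (n - cweight c < n.+1)%N by rewrite ltnS leq_subr.
rewrite hatPsi_triangular -/n (stable _ n.+2 c lt (ltnW lt)) SE.
rewrite -[RHS]addr0 -addrA; congr (_ + _).
rewrite addrC; apply/eqP; rewrite subr_eq0; apply/eqP.
rewrite /U big_seq_cond [RHS]big_seq_cond.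
by apply: eq_bigr => u; rewrite mem_words => /andP[/eqP un _]; rewrite csize_pcl un.
Qed.

End Quotient.

(** * Riemann-Stieltjes integrals *)

Section UniformContinuity.
Variables (R : realType) (a b : R).
Implicit Type f : R -> R.

(** Uniform continuity on the interval [a, b], where it is equivalent to
    continuity. *)
Definition ucont f := forall e, 0 < e -> exists2 d, 0 < d &
  forall x y, a <= x <= b -> a <= y <= b -> `|x - y| < d -> `|f x - f y| < e.

Lemma ucontP f : {within `[a, b], continuous f} <-> ucont f.
Proof.
split=> [/subspace_continuousP cf e e0|uf].
  have e20 : 0 < e / 2 by rewrite divr_gt0.
  have /compact_near_coveringP cov := @segment_compact R a b.
  (* near x the modulus of continuity holds for all small d; compactness makes it
   hold for one d *)
  pose P d x := x \in `[a, b] -> forall y, a <= y <= b -> `|x - y| < d -> `|f x - f y| < e.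
  have /cov : forall x, `[a, b]%classic x -> \forall x' \near x & d \near (0:R)^'+, P d x'.
    move=> x xab; have /cvgrPdist_lt/(_ _ e20) := cf x xab.
    rewrite nearE /= => -[d /= d0 xd].
    have d20 : 0 < d / 2 by rewrite divr_gt0.
    exists (ball x (d / 2), [set r | 0 < r < d / 2]) => /=.
      split; first exact: nbhsx_ballx.
      by near=> r; apply/andP; split.
    move=> [x' r] /= [xx' /andP[_ rd]] x'ab y yab x'y.
    have Hx' : `|f x - f x'| < e / 2.
      apply: xd; last by move: x'ab; rewrite inE.
      by apply: lt_le_trans xx' _; rewrite ler_pdivrMr// ler_pMr// ler1n.
    have dxy : `|x - y| < d.
      rewrite [ltRHS](splitr d) -(subrKA x'); apply: le_lt_trans (ler_normD _ _) _.
      by apply: ltrD => //; exact: lt_trans x'y _.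
    have Hy : `|f x - f y| < e / 2 by apply: xd => //=; rewrite in_itv.
    rewrite [ltRHS](splitr e) -(subrKA (f x)); apply: le_lt_trans (ler_normD _ _) _.
    by apply: ltrD => //; rewrite distrC.
  rewrite nearE => -[d /= d0 H].
  exists (d / 2); first by rewrite divr_gt0.
  move=> x y xab yab xy; apply: (H (d / 2)) => //=.
  - by rewrite sub0r normrN gtr0_norm ?divr_gt0// ltr_pdivrMr// ltr_pMr// ltr1n.
  - by rewrite divr_gt0.
apply/subspace_continuousP => x xab; apply/cvgrPdist_lt => e /uf[d d0 H].
rewrite nearE; exists d => //= y xy yab.
by apply: H => //; move: xab yab; rewrite /= !in_itv.
Unshelve. all: by end_near. Qed.

Lemma ucont_bounded f : ucont f -> exists2 B, 0 < B & forall x, a <= x <= b -> `|f x| <= B.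
Proof.
move=> /ucontP cf.
have := compact_bounded (continuous_compact cf (@segment_compact R a b)).
move=> [M [_ H]]; exists (`|M| + 1); first by rewrite ltr_pwDr.
move=> x xab; apply: (H (`|M| + 1)).
  by rewrite (le_lt_trans (ler_norm M))// ltrDl.
by exists x.
Qed.

Lemma ucontM f g : ucont f -> ucont g -> ucont (fun x => f x * g x).
Proof.
move=> /ucontP cf /ucontP cg; apply/ucontP => x.
by apply: cvgM; [exact: cf|exact: cg].
Qed.

Lemma ucontB f g : ucont f -> ucont g -> ucont (fun x => f x - g x).
Proof.
move=> /ucontP cf /ucontP cg; apply/ucontP => x.
by apply: cvgB; [exact: cf|exact: cg].
Qed.

Lemma ucont_cst c : ucont (fun=> c).
Proof. by move=> e e0; exists 1 => // x y _ _ _; rewrite subrr normr0. Qed.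

Lemma ucont_prod (I : Type) (s : seq I) (F : I -> R -> R) :
  (forall i, ucont (F i)) -> ucont (fun x => \prod_(i <- s) F i x).
Proof.
move=> H; elim: s => [|i s IH].
  by under eq_fun do rewrite big_nil; exact: ucont_cst.
by under eq_fun do rewrite big_cons; exact: ucontM.
Qed.

Lemma ucontX f n : ucont f -> ucont (fun x => f x ^+ n).
Proof.
move=> uf; elim: n => [|n IH]; first exact: ucont_cst.
by under eq_fun do rewrite exprS; exact: ucontM.
Qed.

Lemma eq_ucont f g : (forall x, a <= x <= b -> f x = g x) -> ucont f -> ucont g.
Proof.
move=> fg uf e /uf[d d0 H]; exists d => // x y xab yab.
by rewrite -!fg//; exact: H.
Qed.

End UniformContinuity.

Section Partitions.
Variable R : realType.
Implicit Types (a b : R) (s : seq R).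

Lemma itv_partition_lt a b s n : itv_partition a b s -> (n < size s)%N ->
  nth b (a :: s) n < nth b (a :: s) n.+1.
Proof. by move=> [/(pathP b) H _] ns; exact: H. Qed.

Lemma itv_partition_in a b s n : itv_partition a b s -> (n <= size s)%N ->
  a <= nth b (a :: s) n <= b.
Proof.
by move=> abs ns; rewrite itv_partition_nth_ge// itv_partition_nth_le.
Qed.

Lemma exists_partition a b d : a <= b -> 0 < d -> exists2 s, itv_partition a b s &
  forall n, (n < size s)%N -> nth b (a :: s) n.+1 - nth b (a :: s) n < d.
Proof.
rewrite le_eqVlt => /predU1P[->|ab] d0; first by exists [::] => //; split.
pose N := (Num.truncn ((b - a) / d)).+1.
have N0 : 0 < N%:R :> R by rewrite ltr0n.
have bad : (b - a) / N%:R < d.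
  rewrite ltr_pdivrMr// mulrC -ltr_pdivrMr//.
  by have /andP[] := truncn_itv (divr_ge0 (ltW (eqbRL (subr_gt0 a b) ab)) (ltW d0)).
pose q n : R := a + (b - a) / N%:R * n%:R.
pose s := mkseq (fun n => q n.+1) N.
have qE n : (n <= N)%N -> nth b (a :: s) n = q n.
  case: n => [|n] nN /=; first by rewrite /q mulr0 addr0.
  by rewrite nth_mkseq.
exists s; last first.
  move=> n; rewrite size_mkseq => nN; rewrite !qE//; last exact: ltnW.
  by rewrite /q opprD addrACA subrr add0r -mulrBr -natrB// subSnn mulr1.
split.
  apply/(pathP b) => i; rewrite size_mkseq => iN.
  rewrite -[nth b s i]/(nth b (a :: s) i.+1) !qE//; last exact: ltnW.
  by rewrite /q ltrD2l ltr_pM2l ?ltr_nat// divr_gt0// subr_gt0.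
rewrite (last_nth b) size_mkseq qE// /q -mulrA mulVf ?lt0r_neq0// mulr1.
by rewrite addrC subrK.
Qed.

End Partitions.

Section RiemannStieltjes.
Variable R : realType.
Implicit Types (a b t : R) (f g : R -> R) (s : seq R) (xi : nat -> R).

Definition RSsum a b f g s xi :=
  \sum_(0 <= n < size s) f (xi n) * (g (nth b (a :: s) n.+1) - g (nth b (a :: s) n)).

Definition tagged_partition a b d s xi :=
  [/\ itv_partition a b s,
     forall n, (n < size s)%N -> nth b (a :: s) n.+1 - nth b (a :: s) n < d &
     forall n, (n < size s)%N -> nth b (a :: s) n <= xi n <= nth b (a :: s) n.+1].

Lemma is_RS_integralP a b f g l : is_RS_integral a b f g l <->
  forall e, 0 < e -> exists2 d, 0 < d &
    forall s xi, tagged_partition a b d s xi -> `|RSsum a b f g s xi - l| < e.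
Proof.
split=> H e /H[d d0 {}H]; exists d => //.
  by move=> s xi [? ? ?]; exact: H.
by move=> s xi abs p ? ?; exact: H.
Qed.

Lemma exists_tagged_partition a b d : a <= b -> 0 < d ->
  exists s xi, tagged_partition a b d s xi.
Proof.
move=> ab d0; have [s abs H] := exists_partition ab d0.
exists s, (nth b (a :: s)); split => // n ns; rewrite lexx /=.
exact/ltW/itv_partition_lt.
Qed.

Lemma is_RS_integral_unique a b f g l l' : a <= b -> is_RS_integral a b f g l ->
  is_RS_integral a b f g l' -> l = l'.
Proof.
move=> ab /is_RS_integralP Hl /is_RS_integralP Hl'; apply/eqP/negPn/negP => ll'.
have e0 : 0 < `|l - l'| / 2 by rewrite divr_gt0// normr_gt0 subr_eq0.
have [d d0 {}Hl] := Hl _ e0; have [d' d'0 {}Hl'] := Hl' _ e0.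
have dd0 : 0 < Num.min d d' by rewrite lt_min d0.
have [s [xi [p m x]]] := exists_tagged_partition ab dd0.
have H1 : tagged_partition a b d s xi.
  by split=> // n /m; rewrite lt_min => /andP[].
have H2 : tagged_partition a b d' s xi.
  by split=> // n /m; rewrite lt_min => /andP[].
have : `|l - l'| < `|l - l'|.
  rewrite [ltRHS]splitr -{1}(subrKA (RSsum a b f g s xi)).
  apply: le_lt_trans (ler_normD _ _) _; apply: ltrD; last exact: Hl'.
  by rewrite distrC; exact: Hl.
by rewrite ltxx.
Qed.

Lemma RS_integral_eq a b f g l : a <= b -> is_RS_integral a b f g l ->
  RS_integral a b f g = l.
Proof.
move=> ab H; rewrite /RS_integral; case: xgetP => [l' _ H'|/(_ l)//].
exact: is_RS_integral_unique ab H' H.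
Qed.

Lemma RSsum_eqf a b f f' g s xi d : (forall x, a <= x <= b -> f x = f' x) ->
  tagged_partition a b d s xi -> RSsum a b f g s xi = RSsum a b f' g s xi.
Proof.
move=> ff' [p _ x]; rewrite /RSsum big_nat [RHS]big_nat; apply: eq_bigr => n /= ns.
rewrite ff'//; have /andP[x1 x2] := x n ns.
have /andP[p1 _] := itv_partition_in p (ltnW ns).
by have /andP[_ p2] := itv_partition_in p ns; rewrite (le_trans p1)//= (le_trans x2).
Qed.

Lemma is_RS_integral_eqf a b f f' g l : (forall x, a <= x <= b -> f x = f' x) ->
  is_RS_integral a b f g l -> is_RS_integral a b f' g l.
Proof.
move=> ff' /is_RS_integralP H; apply/is_RS_integralP => e /H[d d0 {}H].
by exists d => // s xi t; rewrite -(RSsum_eqf _ ff' t); exact: H.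
Qed.

Lemma RS_integral_eqf a b f f' g : (forall x, a <= x <= b -> f x = f' x) ->
  RS_integral a b f g = RS_integral a b f' g.
Proof.
move=> ff'; rewrite /RS_integral; congr (xget 0 _); apply/seteqP; split => l /=.
  exact: is_RS_integral_eqf.
by apply: is_RS_integral_eqf => x xab; rewrite ff'.
Qed.

Lemma is_RS_integralZ a b f g l c :
  is_RS_integral a b f g l -> is_RS_integral a b (fun x => c * f x) g (c * l).
Proof.
move=> /is_RS_integralP H; apply/is_RS_integralP => e e0.
have c0 : 0 < `|c| + 1 by rewrite ltr_pwDr.
have [d d0 {}H] := H _ (divr_gt0 e0 c0); exists d => // s xi /H.
rewrite ltr_pdivlMr// => {}H; apply: le_lt_trans H.
have -> : RSsum a b (fun x => c * f x) g s xi = c * RSsum a b f g s xi.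
  by rewrite /RSsum mulr_sumr; apply: eq_bigr => n _; rewrite mulrA.
by rewrite -mulrBr normrM mulrC ler_wpM2l// lerDl.
Qed.

(** When f has no integral and c is nonzero, c f has none either, and both sides
    are the default value 0. *)
Lemma RS_integralZ a b f g c : a <= b ->
  RS_integral a b (fun x => c * f x) g = c * RS_integral a b f g.
Proof.
move=> ab; have [->|c0] := eqVneq c 0.
  rewrite mul0r; apply: (RS_integral_eq ab).
  apply/is_RS_integralP => e e0; exists 1 => // s xi _.
  by rewrite /RSsum big1 ?subrr ?normr0// => n _; rewrite !mul0r.
have [[l Hl]|nex] := pselect (exists l, is_RS_integral a b f g l).
  by rewrite (RS_integral_eq ab Hl) (RS_integral_eq ab (is_RS_integralZ c Hl)).
rewrite /RS_integral; case: xgetP => [l _ Hl|_].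
  case: nex; exists (c^-1 * l); have := is_RS_integralZ c^-1 Hl.
  by under eq_fun do rewrite mulKf//.
case: xgetP => [l _ Hl|_]; last by rewrite mulr0.
by case: nex; exists l.
Qed.

(** G behaves like the indefinite integral of f dg: its increments are those of
    a Riemann sum up to the oscillation of f times the increment of V, where V is
    a monotone function that dominates the variation of g. *)
Definition primitive a b f g (V G : R -> R) := forall u v c e,
  a <= u -> u <= v -> v <= b -> (forall x, u <= x <= v -> `|f x - c| <= e) ->
  `|G v - G u - c * (g v - g u)| <= e * (V v - V u).

(** The error of a Riemann sum telescopes to the oscillation of f on the mesh times
    the increment of V. *)
Lemma primitive_RS a b f g V G t : ucont a b f ->
  {in `[a, b] &, {homo V : x y / x <= y}} ->
  primitive a b f g V G -> a <= t <= b -> is_RS_integral a t f g (G t - G a).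
Proof.
move=> uf ndV pG /andP[at_ tb]; apply/is_RS_integralP => e e0.
have ta : t \in `[a, b] by rewrite in_itv /= at_.
have aa : a \in `[a, b] by rewrite in_itv /= lexx (le_trans at_).
have V0 : 0 <= V t - V a by rewrite subr_ge0 ndV.
have V1 : 0 < V t - V a + 1 by rewrite ltr_pwDr.
have [d d0 H] := uf _ (divr_gt0 e0 V1); exists d => // s xi [p m x].
have tele (F : R -> R) : F t - F a =
    \sum_(0 <= n < size s) (F (nth t (a :: s) n.+1) - F (nth t (a :: s) n)).
  by rewrite telescope_sumr//= (itv_partition_nth_size _ p).
rewrite (tele G) /RSsum -sumrB; apply: le_lt_trans (ler_norm_sum _ _ _) _.
apply: (@le_lt_trans _ _ (e / (V t - V a + 1) * (V t - V a))); last first.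
  by rewrite -mulrA gtr_pMr// mulrC ltr_pdivrMr// mul1r ltrDl.
rewrite (tele V) mulr_sumr big_nat [leRHS]big_nat; apply: ler_sum => n /= ns.
have /andP[p1 p2] := itv_partition_in p (ltnW ns).
have /andP[p3 p4] := itv_partition_in p ns.
have /andP[x1 x2] := x n ns.
rewrite -tele distrC; apply: pG => //; first exact: ltW (itv_partition_lt p ns).
  exact: le_trans tb.
move=> y /andP[y1 y2]; apply/ltW/H.
- by rewrite (le_trans p1)//= (le_trans y2)// (le_trans p4).
- by rewrite (le_trans p1)//= (le_trans x2)// (le_trans p4).
apply: le_lt_trans (m n ns); rewrite ler_norml opprB.
by rewrite lerB//= lerB.
Qed.

End RiemannStieltjes.

(** * Existence of Riemann-Stieltjes integrals *)

Section Stieltjes.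
Variables (R : realType) (a b : R).
Implicit Types f g : R -> R.

Section Monotone.
Variable g : cumulative R R.

Let mu := lebesgue_stieltjes_measure g.

Let mu_itv u v : u <= v -> mu `]u, v]%classic = (g v - g u)%:E.
Proof.
move=> uv; rewrite /mu /lebesgue_stieltjes_measure /measure_extension /=.
by rewrite measurable_mu_extE /= ?wlength_itv_bnd//; exact: is_ocitv.
Qed.

(** The primitive is the integral against the Stieltjes measure of g over the
    half-open intervals from a. *)
Lemma monotone_primitive f : ucont a b f -> exists G, primitive a b f g g G.
Proof.
move=> uf; have [B B0 fB] := ucont_bounded uf.
have mitv (u v : R) : measurable (`]u, v]%classic : set (measurableTypeR R)).
  exact: measurable_itv.
have muy u v : u <= v -> (mu `]u, v]%classic < +oo)%E.
  by move=> uv; rewrite mu_itv// ltry.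
have fint u v : a <= u -> u <= v -> v <= b ->
    mu.-integrable `]u, v]%classic (EFin \o f).
  move=> au uv vb; apply: measurable_bounded_integrable => //.
  - exact: muy.
  - have /subspace_continuous_measurable_fun mf : {within `[a, b], continuous f}.
      exact/ucontP.
    apply: measurable_funS (mf _) => //; try exact: measurable_itv.
    move=> x /=; rewrite !in_itv /= => /andP[ux xv].
    by rewrite (le_trans au (ltW ux)) (le_trans xv vb).
  - exists B; split; first exact: num_real.
    move=> C BC x /=; rewrite in_itv /= => /andP[ux xv].
    apply: le_trans (ltW BC); apply: fB.
    by rewrite (le_trans au (ltW ux)) (le_trans xv vb).
pose G t := \int[mu]_(x in `]a, t]) f x.
exists G => u v c e au uv vb fc.
have itvE : `]a, v]%classic = `]a, u]%classic `|` `]u, v]%classic.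
  by rewrite -itv_bndbnd_setU ?bnd_simp.
have Guv : G v = G u + \int[mu]_(x in `]u, v]) f x.
  rewrite /G itvE Rintegral_setU//.
    by rewrite -itvE; apply: fint => //; exact: le_trans uv.
  apply/disj_setPS => x /=; rewrite !in_itv /= => -[/andP[_ xu] /andP[ux _]].
  by move: (lt_le_trans ux xu); rewrite ltxx.
have -> : G v - G u = \int[mu]_(x in `]u, v]) f x by rewrite Guv addrAC subrr add0r.
have cint (r : R) : mu.-integrable `]u, v]%classic (EFin \o fun=> r).
  apply: measurable_bounded_integrable => //; first exact: muy.
  exists `|r|; split; first exact: num_real.
  by move=> C rC x _; exact: ltW.
have mE : fine (mu `]u, v]%classic) = g v - g u by rewrite mu_itv.
have icst r : r * (g v - g u) = \int[mu]_(x in `]u, v]) r.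
  by rewrite Rintegral_cst// mE.
rewrite !icst -RintegralB//; last exact: fint.
apply: le_trans (le_normr_Rintegral _ _) _ => //.
  apply: (@integrableB _ _ _ mu _ _ (EFin \o f) (EFin \o fun=> c)) => //; exact: fint.
apply: le_Rintegral => //.
- apply: (@integrable_norm _ _ _ mu _ (fun x => f x - c)).
  by apply: (@integrableB _ _ _ mu _ _ (EFin \o f) (EFin \o fun=> c)) => //; exact: fint.
- move=> x /=; rewrite in_itv /= => /andP[ux xv].
  by apply: fc; rewrite (ltW ux).
Qed.

End Monotone.

Hypothesis ab : a < b.

(** Composition with it extends a function on the interval [a, b] by its values at
    the end points; a Stieltjes measure needs a function on the whole line. *)
Definition clamp x := Num.max a (Num.min x b).

Lemma clamp_in x : a <= clamp x <= b.
Proof. by rewrite /clamp le_max lexx ge_max (ltW ab) ge_min lexx orbT. Qed.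

Lemma clamp_id x : a <= x <= b -> clamp x = x.
Proof. by move=> /andP[ax xb]; rewrite /clamp min_l// max_r. Qed.

Lemma clamp_homo : {homo clamp : x y / x <= y}.
Proof.
move=> x y xy; rewrite /clamp ge_max le_max lexx /= le_max; apply/orP; right.
by rewrite le_min !ge_min xy lexx !orbT.
Qed.

Lemma clamp_lip x y : `|clamp x - clamp y| <= `|x - y|.
Proof.
wlog xy : x y / x <= y => [H|].
  by case: (leP x y) => [/H//|/ltW/H]; rewrite distrC [leRHS]distrC.
rewrite !ler0_norm ?subr_le0 ?clamp_homo// lerN2.
rewrite /clamp; case: (leP x b) => xb; case: (leP y b) => yb;
  rewrite ?(max_r (ltW ab)); case: (leP a x) => ax; case: (leP a y) => ay; lra.
Qed.

Lemma monotone_on_primitive f g : ucont a b f -> ucont a b g ->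
  {in `[a, b] &, {homo g : x y / x <= y}} -> exists G, primitive a b f g g G.
Proof.
move=> uf ug ndg.
have nd : {homo g \o clamp : x y / x <= y}.
  move=> x y xy /=; have inab z : clamp z \in `[a, b] by rewrite in_itv /= clamp_in.
  exact: (ndg _ _ (inab x) (inab y) (clamp_homo xy)).
have cg : continuous (g \o clamp).
  move=> x; apply/cvgrPdist_lt => e /ug[d d0 H].
  rewrite nearE; exists d => //= y xy; apply: H; rewrite ?clamp_in//.
  exact: le_lt_trans (clamp_lip _ _) xy.
pose gc : cumulative R R :=
  HB.pack (g \o clamp) (isCumulative.Build R _ R (g \o clamp) nd (right_continuousW cg)).
have [G pG] := @monotone_primitive gc _ uf.
exists G => u v c e au uv vb fc.
have := pG u v c e au uv vb fc; rewrite /= !clamp_id// ?au ?vb ?andbT//.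
  exact: le_trans uv vb.
exact: le_trans au uv.
Qed.

Section BoundedVariation.
Variables g : R -> R.
Hypotheses (ug : ucont a b g) (bv : bounded_variation a b g).

Definition tv t := fine (total_variation a t g).

Lemma tv_ucont : ucont a b tv.
Proof. by apply/ucontP; apply: total_variation_continuous => //; exact/ucontP. Qed.

Lemma tv_ge u v : a <= u -> u <= v -> v <= b -> `|g v - g u| <= tv v - tv u.
Proof.
move=> au uv vb; rewrite lerBrDl -lee_fin EFinD /tv.
have fu : total_variation a u g \is a fin_num.
  apply/bounded_variationP => //; apply: bounded_variationl bv => //.
  exact: le_trans uv vb.
have fv : total_variation a v g \is a fin_num.
  apply/bounded_variationP => //; first exact: le_trans au uv.
  by apply: bounded_variationl bv => //; exact: le_trans au uv.
rewrite !fineK// (total_variationD g au uv) leeD2l//.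
exact: total_variation_ge.
Qed.

(** g is the difference of tv and tv - g, which are continuous and nondecreasing;
    the dominating V is their sum. *)
Lemma exists_primitive f : ucont a b f -> exists G V,
  [/\ ucont a b V, {in `[a, b] &, {homo V : x y / x <= y}},
   forall u v, a <= u -> u <= v -> v <= b -> `|g v - g u| <= V v - V u &
   primitive a b f g V G].
Proof.
move=> uf.
have nd1 : {in `[a, b] &, {homo tv : x y / x <= y}}.
  move=> x y; rewrite !in_itv /= => /andP[ax xb] /andP[ay yb] xy.
  by rewrite -subr_ge0; apply: le_trans (tv_ge ax xy yb).
have nd2 : {in `[a, b] &, {homo (fun t => tv t - g t) : x y / x <= y}}.
  move=> x y; rewrite !in_itv /= => /andP[ax xb] /andP[ay yb] xy.
  have := tv_ge ax xy yb; rewrite ler_norml; lra.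
have u2 : ucont a b (fun t => tv t - g t) by apply: ucontB => //; exact: tv_ucont.
have [G1 p1] := monotone_on_primitive uf tv_ucont nd1.
have [G2 p2] := monotone_on_primitive uf u2 nd2.
exists (fun t => G1 t - G2 t), (fun t => tv t - (0 - (tv t - g t))); split.
- apply: ucontB; first exact: tv_ucont.
  by apply: ucontB => //; exact: ucont_cst.
- by move=> x y xab yab xy; have := nd1 x y xab yab xy; have := nd2 x y xab yab xy; lra.
- move=> u v au uv vb; have := tv_ge au uv vb.
  have : tv u - g u <= tv v - g v.
    by apply: nd2 => //; rewrite in_itv /= ?au ?vb ?(le_trans au uv) ?(le_trans uv vb).
  lra.
- move=> u v c e au uv vb fc.
  have := p1 u v c e au uv vb fc; have := p2 u v c e au uv vb fc.
  rewrite !ler_norml; lra.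
Qed.

Lemma RS_integralP f t : ucont a b f -> a <= t <= b ->
  is_RS_integral a t f g (RS_integral a t f g).
Proof.
move=> uf tab; have [G [V [_ ndV _ pG]]] := exists_primitive uf.
have H := primitive_RS uf ndV pG tab.
by case/andP: tab => at_ _; rewrite (RS_integral_eq at_ H).
Qed.

Lemma RS_integral_ucont f : ucont a b f -> ucont a b (fun t => RS_integral a t f g).
Proof.
move=> uf; have [G [V [uV ndV _ pG]]] := exists_primitive uf.
have E t : a <= t <= b -> RS_integral a t f g = G t - G a.
  move=> tab; have H := primitive_RS uf ndV pG tab.
  by case/andP: tab => at_ _; rewrite (RS_integral_eq at_ H).
have [B B0 fB] := ucont_bounded uf.
have GV x y : a <= x -> x <= y -> y <= b -> `|G y - G x| <= B * `|V y - V x|.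
  move=> ax xy yb; have := @pG x y 0 B ax xy yb; rewrite mul0r subr0 => H.
  apply: le_trans (H _) _.
    move=> z /andP[xz zy]; rewrite subr0 fB//.
    by rewrite (le_trans ax xz) (le_trans zy yb).
  by rewrite ler_wpM2l ?ler_norm// ltW.
have uG : ucont a b (fun t => G t - G a).
  move=> e e0; have [d d0 H] := uV _ (divr_gt0 e0 B0); exists d => // x y xab yab xy.
  rewrite opprB addrA subrK; have := H x y xab yab xy.
  rewrite ltr_pdivlMr// mulrC; apply: le_lt_trans.
  case/andP: xab yab => ax xb /andP[ay yb].
  by case: (leP x y) => [xy'|/ltW xy']; [rewrite distrC [X in _ * X]distrC|]; exact: GV.
by apply: eq_ucont uG => x xab; rewrite E.
Qed.

End BoundedVariation.
End Stieltjes.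

(** * Limits of means under a mean-square bound *)

Section SquareIntegrable.
Context {d : measure_display} {Omega : measurableType d} {R : realType}.
Variable P : probability Omega R.
Implicit Types (F G : Omega -> R) (M : R).

(** The bound is on the extended-real integral so that it includes the
    integrability of the square. *)
Definition sq_bounded M F := measurable_fun [set: Omega] F /\
  (\int[P]_w ((F w) ^+ 2)%:E <= M%:E)%E.

Definition mean F : R := \int[P]_w F w.

Lemma measurable_prodr (I : Type) (s : seq I) (F : I -> Omega -> R) :
  (forall i, measurable_fun [set: Omega] (F i)) ->
  measurable_fun [set: Omega] (fun w => \prod_(i <- s) F i w).
Proof.
move=> mF; elim: s => [|i s IH].
  by under eq_fun do rewrite big_nil; exact: measurable_cst.
by under eq_fun do rewrite big_cons; exact: measurable_funM.
Qed.

Lemma integrable_mean F : P.-integrable [set: Omega] (EFin \o F) ->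
  (\int[P]_w (F w)%:E)%E = (mean F)%:E.
Proof. by move=> iF; rewrite /mean /Rintegral fineK//; exact: integrable_fin_num. Qed.

Lemma sq_bounded_sq M F : sq_bounded M F ->
  P.-integrable [set: Omega] (EFin \o (fun w => F w ^+ 2)).
Proof.
move=> [mF FM]; apply/integrableP; split.
  by apply/measurable_EFinP; exact: measurable_funX.
apply: le_lt_trans (ltry M); apply: le_trans FM; apply: ge0_le_integral => //.
- apply: measurableT_comp => //; apply/measurable_EFinP; exact: measurable_funX.
- by apply/measurable_EFinP; exact: measurable_funX.
by move=> w _ /=; rewrite ger0_norm// sqr_ge0.
Qed.

Lemma sq_bounded_integrable M F : sq_bounded M F -> P.-integrable [set: Omega] (EFin \o F).
Proof.
move=> FM; have iF := sq_bounded_sq FM; have [mF _] := FM.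
have i1 : P.-integrable [set: Omega] (EFin \o (fun=> 1 : R)).
  exact: finite_measure_integrable_cst.
have := integrableD measurableT i1 iF; apply: le_integrable => //.
  exact/measurable_EFinP.
move=> w _ /=; rewrite lee_fin [leRHS]ger0_norm ?addr_ge0 ?sqr_ge0//.
have := sqr_ge0 (`|F w| - 1); rewrite sqrrB expr1n mulr1 real_normK ?num_real//.
have := normr_ge0 (F w); have := sqr_ge0 (F w); lra.
Qed.

Lemma mean_sq_le M F : sq_bounded M F -> mean (fun w => F w ^+ 2) <= M.
Proof.
move=> FM; rewrite -lee_fin -integrable_mean; first by case: FM.
exact: sq_bounded_sq FM.
Qed.

Lemma le_sq_bounded M M' F : M <= M' -> sq_bounded M F -> sq_bounded M' F.
Proof. by move=> MM [mF FM]; split => //; apply: le_trans FM _; rewrite lee_fin. Qed.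

Lemma sqr_sum_le_step (c x S C Q : R) : 0 <= C -> 0 <= Q -> S ^+ 2 <= C * Q ->
  (c * x + S) ^+ 2 <= (`|c| + C) * (`|c| * x ^+ 2 + Q).
Proof.
move=> C0 Q0 SCQ.
have x2 := sqr_ge0 x.
have z0 : 0 <= Q + C * x ^+ 2 by rewrite addr_ge0// mulr_ge0.
have cross : `|2 * x * S| <= Q + C * x ^+ 2.
  rewrite -ler_sqr ?nnegrE// real_normK ?num_real// -subr_ge0.
  have -> : (Q + C * x ^+ 2) ^+ 2 - (2 * x * S) ^+ 2 =
    (Q - C * x ^+ 2) ^+ 2 + 4 * (x ^+ 2 * (C * Q - S ^+ 2)) by ring.
  by rewrite addr_ge0 ?sqr_ge0// mulr_ge0// mulr_ge0// subr_ge0.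
have cc : `|c| * `|2 * x * S| <= `|c| * (Q + C * x ^+ 2) by rewrite ler_wpM2l.
have c2 : c ^+ 2 = `|c| ^+ 2 by rewrite real_normK ?num_real.
have := ler_norm (c * (2 * x * S)); rewrite normrM.
have -> : (c * x + S) ^+ 2 = c ^+ 2 * x ^+ 2 + c * (2 * x * S) + S ^+ 2 by ring.
have -> : (`|c| + C) * (`|c| * x ^+ 2 + Q) =
  `|c| ^+ 2 * x ^+ 2 + `|c| * (Q + C * x ^+ 2) + C * Q by ring.
rewrite c2; lra.
Qed.

(** Cauchy-Schwarz with weights |c_i|. *)
Lemma sqr_sum_le (I : Type) (s : seq I) (c x : I -> R) :
  (\sum_(i <- s) c i * x i) ^+ 2 <=
  (\sum_(i <- s) `|c i|) * \sum_(i <- s) `|c i| * x i ^+ 2.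
Proof.
elim: s => [|i s IH]; first by rewrite !big_nil expr0n mul0r.
rewrite !big_cons; apply: sqr_sum_le_step => //; first by apply: sumr_ge0.
by apply: sumr_ge0 => j _; rewrite mulr_ge0 ?sqr_ge0.
Qed.

Lemma sq_bounded_sum (I : eqType) (s : seq I) (c : I -> R) (F : I -> Omega -> R) M :
  (forall i, i \in s -> sq_bounded M (F i)) ->
  sq_bounded ((\sum_(i <- s) `|c i|) ^+ 2 * M) (fun w => \sum_(i <- s) c i * F i w).
Proof.
(* outside s nothing is known about F, not even measurability *)
pose F' i := if i \in s then F i else (fun=> 0).
move=> H.
have mF' i : measurable_fun [set: Omega] (F' i).
  by rewrite /F'; case: ifP => [/H[]//|_]; exact: measurable_cst.
have eF w : \sum_(i <- s) c i * F i w = \sum_(i <- s) c i * F' i w.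
  by rewrite big_seq [RHS]big_seq; apply: eq_bigr => i; rewrite /F' => ->.
rewrite (funext eF).
set C := \sum_(i <- s) `|c i|.
have C0 : 0 <= C by apply: sumr_ge0.
have msum : measurable_fun [set: Omega] (fun w => \sum_(i <- s) c i * F' i w).
  apply: measurable_sum => i; apply: measurable_funM => //; exact: measurable_cst.
split => //.
have mq i : measurable_fun [set: Omega] (fun w => (`|c i| * F' i w ^+ 2)%:E).
  apply/measurable_EFinP/measurable_funM; first exact: measurable_cst.
  exact: measurable_funX.
have q0 i w : (0 <= (`|c i| * F' i w ^+ 2)%:E)%E.
  by rewrite lee_fin mulr_ge0// sqr_ge0.
apply: (@le_trans _ _ (\int[P]_w (C%:E * \sum_(i <- s) (`|c i| * F' i w ^+ 2)%:E))%E).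
  apply: ge0_le_integral => //.
  - by move=> w _; rewrite lee_fin sqr_ge0.
  - by apply/measurable_EFinP; exact: measurable_funX.
  - apply: measurable_funeM; apply: emeasurable_sum => i; exact: mq.
  - by move=> w _; rewrite sumEFin -EFinM lee_fin; exact: sqr_sum_le.
rewrite ge0_integralZl//; last 2 first.
- apply: emeasurable_sum => i; exact: mq.
- by move=> w _; apply: sume_ge0 => i _; exact: q0.
rewrite ge0_integral_sum// expr2 -mulrA EFinM lee_wpmul2l ?lee_fin//.
rewrite mulr_suml -sumEFin big_seq [leRHS]big_seq; apply: lee_sum => i si.
under eq_integral do rewrite EFinM.
rewrite ge0_integralZl//.
- by rewrite EFinM lee_wpmul2l ?lee_fin//; have [] := H i si; rewrite /F' si.
- by apply/measurable_EFinP; exact: measurable_funX.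
- by move=> w _; rewrite lee_fin sqr_ge0.
Qed.

Lemma mean_sum (I : eqType) (s : seq I) (c : I -> R) (F : I -> Omega -> R) :
  (forall i, i \in s -> P.-integrable [set: Omega] (EFin \o F i)) ->
  P.-integrable [set: Omega] (EFin \o (fun w => \sum_(i <- s) c i * F i w)) /\
  mean (fun w => \sum_(i <- s) c i * F i w) = \sum_(i <- s) c i * mean (F i).
Proof.
elim: s => [_|i s IH H].
  split; last first.
    rewrite big_nil /mean; under eq_Rintegral do rewrite big_nil.
    by rewrite Rintegral_cst// mul0r.
  by under eq_fun do rewrite big_nil; exact: finite_measure_integrable_cst.
have [iS ES] : P.-integrable [set: Omega] (EFin \o (fun w => \sum_(i <- s) c i * F i w)) /\
  mean (fun w => \sum_(i <- s) c i * F i w) = \sum_(i <- s) c i * mean (F i).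
  by apply: IH => j js; apply: H; rewrite in_cons js orbT.
have iF : P.-integrable [set: Omega] (EFin \o F i) by apply: H; rewrite mem_head.
have icF : P.-integrable [set: Omega] (EFin \o (fun w => c i * F i w)).
  exact: (integrableZl measurableT (c i) iF).
split.
  under eq_fun do rewrite big_cons.
  exact: (integrableD measurableT icF iS).
rewrite big_cons -ES /mean.
under eq_Rintegral do rewrite big_cons.
by rewrite RintegralD// RintegralZl.
Qed.

(** Fatou's lemma for the squares. *)
Lemma sq_bounded_lim (S : nat -> Omega -> R) F M : (forall n, sq_bounded M (S n)) ->
  (forall w, (fun n => S n w) @ \oo --> F w) -> sq_bounded M F.
Proof.
move=> SM SF.
have mF : measurable_fun [set: Omega] F.
  apply/measurable_EFinP; apply: (emeasurable_fun_cvg (fun n => EFin \o S n)).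
    by move=> n; apply/measurable_EFinP; case: (SM n).
  by move=> w _; apply: cvg_EFin; [exact: nearW|exact: SF].
split => //.
have mq n : measurable_fun [set: Omega] (fun w => (S n w ^+ 2)%:E).
  by apply/measurable_EFinP/measurable_funX; case: (SM n).
have q0 n w : [set: Omega] w -> (0 <= (S n w ^+ 2)%:E)%E by rewrite lee_fin sqr_ge0.
have := fatou P measurableT mq q0.
have -> : (\int[P]_w limn_einf (fun n => (S n w ^+ 2)%:E) = \int[P]_w (F w ^+ 2)%:E)%E.
  apply: eq_integral => w _.
  have cS : (fun n => (S n w ^+ 2)%:E) @ \oo --> (F w ^+ 2)%:E.
    apply: cvg_EFin; first exact: nearW.
    by rewrite expr2; under eq_fun do rewrite expr2; apply: cvgM; exact: SF.
  by have [-> _] := cvg_limn_einf_sup cS.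
move=> /le_trans; apply.
rewrite limn_einf_lim; apply: lime_le; first exact: is_cvg_einfs.
apply: nearW => n.
apply: le_trans (ereal_inf_lbound _) (_ : (\int[P]_w (S n w ^+ 2)%:E <= _)%E).
  by exists n => /=.
by case: (SM n).
Qed.

(** The mean-square bound makes the sequence uniformly integrable: with D the
    distance of S n to the limit, D is at most min(D, N) + D^2 / N.  The mean of
    the first term tends to 0 by dominated convergence, and that of the second is
    at most 4 M / N. *)
Lemma mean_cvg (S : nat -> Omega -> R) F M : (forall n, sq_bounded M (S n)) ->
  (forall w, (fun n => S n w) @ \oo --> F w) ->
  (fun n => mean (S n)) @ \oo --> mean F.
Proof.
move=> SM SF; have FM := sq_bounded_lim SM SF.
have M0 : 0 <= M.
  case: FM => _; rewrite -lee_fin; apply: le_trans; apply: integral_ge0 => w _.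
  by rewrite lee_fin sqr_ge0.
have [mF _] := FM.
have mS n : measurable_fun [set: Omega] (S n) by case: (SM n).
pose D n w := `|S n w - F w|.
have mD n : measurable_fun [set: Omega] (D n).
  by apply: measurableT_comp => //; exact: measurable_funB.
have D2 n : sq_bounded (4 * M) (D n).
  split => //.
  (* S n - F is a combination of two variables with coefficients 1 and -1 *)
  have := sq_bounded_sum (s := [:: true; false]) (fun b => if b then 1 else -1)
    (F := fun b => if b then S n else F) (M := M).
  rewrite !big_cons !big_nil normrN !normr1 => /(_ _)[|_ H].
    by case.
  have -> : 4 * M = (1 + (1 + 0)) ^+ 2 * M by ring.
  apply: le_trans H; rewrite le_eqVlt; apply/orP; left; apply/eqP.
  apply: eq_integral => w _; congr (_%:E).
  rewrite /D real_normK ?num_real// !big_cons big_nil; ring.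
have iD n := sq_bounded_integrable (D2 n).
apply/cvgrPdist_le => e e0.
(* chosen so that 4 M / N is at most e / 2 *)
pose N : R := 8 * M / e + 1.
have N0 : 0 < N by rewrite ltr_pwDr// divr_ge0 ?(ltW e0)// mulr_ge0.
pose m n w := Num.min (D n w) N.
have mm n : measurable_fun [set: Omega] (m n).
  by apply: measurable_minr => //; exact: measurable_cst.
have mN n w : `|m n w| <= N.
  rewrite ger0_norm; first by rewrite /m ge_min lexx orbT.
  by rewrite /m le_min normr_ge0 ltW.
have iN : P.-integrable [set: Omega] (EFin \o (fun=> N)).
  exact: finite_measure_integrable_cst.
have im n : P.-integrable [set: Omega] (EFin \o m n).
  apply: le_integrable iN => //; first exact/measurable_EFinP.
  by move=> w _ /=; rewrite lee_fin (gtr0_norm N0) mN.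
have DS w : (fun n => D n w) @ \oo --> (0 : R).
  apply/cvgrPdist_le => r r0.
  have /cvgrPdist_le/(_ r r0) := SF w; apply: filterS => n.
  by rewrite sub0r normrN /D normr_id distrC.
have cm : (fun n => mean (m n)) @ \oo --> (0 : R).
  have H : (fun n => \int[P]_w (m n w)%:E)%E @ \oo --> (\int[P]_w (0 : R)%:E)%E.
    apply: (@dominated_cvg _ _ _ P _ measurableT (fun n => EFin \o m n)
      (EFin \o fun=> 0) (EFin \o (fun=> N))) => //.
    - by move=> n; exact/measurable_EFinP.
    - move=> w _; apply: cvg_EFin; first exact: nearW.
      apply/cvgrPdist_le => r r0.
      have /cvgrPdist_le/(_ r r0) := DS w; apply: filterS => n.
      rewrite !sub0r !normrN !ger0_norm ?normr_ge0//; last first.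
        by rewrite /m le_min normr_ge0 ltW.
      by move=> Dr; rewrite /m ge_min Dr.
    - by move=> n w _ /=; rewrite lee_fin.
  by rewrite integral0 in H; exact: fine_cvg H.
have bound n : `|mean F - mean (S n)| <= mean (m n) + e / 2.
  have iF := sq_bounded_integrable FM; have iS := sq_bounded_integrable (SM n).
  rewrite /mean -RintegralB//.
  apply: le_trans (le_normr_Rintegral measurableT _) _.
    exact: (integrableB measurableT iF iS).
  have iD2 := sq_bounded_sq (D2 n).
  have iD2N : P.-integrable [set: Omega] (EFin \o (fun w => N^-1 * D n w ^+ 2)).
    exact: (integrableZl measurableT N^-1 iD2).
  apply: (@le_trans _ _ (\int[P]_w (m n w + N^-1 * D n w ^+ 2))).
    apply: le_Rintegral => //.
    - by apply: le_integrable (iD n) => //;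
        [apply/measurable_EFinP; apply: measurableT_comp => //; exact: measurable_funB|
         move=> w _ /=; rewrite /D distrC].
    - exact: (integrableD measurableT (im n) iD2N).
    move=> w _; rewrite distrC -/(D n w) /m.
    case: (leP (D n w) N) => [_|ND].
      by rewrite lerDl mulr_ge0 ?sqr_ge0// invr_ge0 ltW.
    rewrite expr2 mulrA; apply: (@le_trans _ _ (N^-1 * D n w * D n w)); last first.
      by rewrite lerDr ltW.
    apply: ler_peMl; first exact: normr_ge0.
    by rewrite mulrC ler_pdivlMr// mul1r ltW.
  rewrite RintegralD// RintegralZl// lerD2l mulrC ler_pdivrMr//.
  apply: le_trans (mean_sq_le (D2 n)) _; rewrite /N mulrDr mulr1.
  have -> : e / 2 * (8 * M / e) = 4 * M by field; rewrite lt0r_neq0.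
  by rewrite lerDl divr_ge0// ltW.
have e20 : 0 < e / 2 by rewrite divr_gt0.
have /cvgrPdist_le/(_ _ e20) := cm; apply: filterS => n; rewrite sub0r normrN => mn.
apply: le_trans (bound n) _; rewrite [leRHS](splitr e) lerD2r.
exact: le_trans (ler_norm _) mn.
Qed.

End SquareIntegrable.

(** * Means of iterated integrals *)

Section ExpectedStieltjes.
Context {d : measure_display} {Omega : measurableType d} {R : realType}.
Variable P : probability Omega R.
Variables (a b : R) (ab : a < b) (g : R -> R).
Hypotheses (ug : ucont a b g) (bv : bounded_variation a b g).

Definition total_var := tv a g b - tv a g a.

Lemma partition_variation_le t e s xi : a <= t <= b -> tagged_partition a t e s xi ->
  \sum_(0 <= n < size s) `|g (nth t (a :: s) n.+1) - g (nth t (a :: s) n)| <= total_var.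
Proof.
move=> /andP[at_ tb] [p _ _].
apply: (@le_trans _ _ (tv a g t - tv a g a)).
  have -> : tv a g t - tv a g a =
    \sum_(0 <= n < size s) (tv a g (nth t (a :: s) n.+1) - tv a g (nth t (a :: s) n)).
    rewrite (telescope_sumr (fun n => tv a g (nth t (a :: s) n)))//=.
    by rewrite (itv_partition_nth_size _ p).
  rewrite big_nat [leRHS]big_nat; apply: ler_sum => n /andP[_ ns].
  have /andP[p1 p2] := itv_partition_in p (ltnW ns).
  have /andP[p3 p4] := itv_partition_in p ns.
  apply: (tv_ge bv) => //; first exact: ltW (itv_partition_lt p ns).
  exact: le_trans p4 tb.
rewrite lerB// -subr_ge0; apply: le_trans (tv_ge bv at_ tb (lexx b)); exact: normr_ge0.
Qed.

(** Riemann sums along partitions with mesh tending to 0 converge pointwise and are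
    bounded in mean square, so their means converge.  A sequence of partitions
    whose sums of means stay away from the limit would contradict this. *)
Lemma mean_RS_integral (F : R -> Omega -> R) M t : a <= t <= b ->
  (forall w, ucont a b (F^~ w)) -> (forall u, a <= u <= t -> sq_bounded P M (F u)) ->
  sq_bounded P (total_var ^+ 2 * M) (fun w => RS_integral a t (F^~ w) g) /\
  is_RS_integral a t (fun u => mean P (F u)) g
    (mean P (fun w => RS_integral a t (F^~ w) g)).
Proof.
move=> tab uF FM; have /andP[at_ tb] := tab.
have M0 : 0 <= M.
  have [_] := FM a (etrans (congr1 (andb^~ _) (lexx a)) at_).
  by rewrite -lee_fin; apply: le_trans; apply: integral_ge0 => w _; rewrite lee_fin sqr_ge0.
have E (s : seq R) (xi : nat -> R) (f : R -> R) : RSsum a t f g s xi =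
  \sum_(n <- index_iota 0 (size s))
    (g (nth t (a :: s) n.+1) - g (nth t (a :: s) n)) * f (xi n).
  by apply: eq_bigr => n _; rewrite mulrC.
have inat e s xi n : tagged_partition a t e s xi -> n \in index_iota 0 (size s) ->
    a <= xi n <= t.
  move=> [p _ x]; rewrite mem_index_iota => /andP[_ ns].
  have /andP[p1 p2] := itv_partition_in p (ltnW ns).
  have /andP[p3 p4] := itv_partition_in p ns.
  by have /andP[x1 x2] := x n ns; rewrite (le_trans p1 x1) (le_trans x2 p4).
have SL2 e s xi : tagged_partition a t e s xi ->
    sq_bounded P (total_var ^+ 2 * M) (fun w => RSsum a t (F^~ w) g s xi).
  move=> tp; rewrite (funext (fun w => E s xi (F^~ w))).
  apply: le_sq_bounded (sq_bounded_sum (M := M) _ _); last first.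
    by move=> n /(inat _ _ _ _ tp); exact: FM.
  have := partition_variation_le tab tp.
  set C := \sum_(i <- _) _ => CV; rewrite ler_wpM2r// ler_sqr ?nnegrE//.
    exact: sumr_ge0.
  by apply: le_trans CV; exact: sumr_ge0.
have ExS e s xi : tagged_partition a t e s xi ->
    mean P (fun w => RSsum a t (F^~ w) g s xi) = RSsum a t (fun u => mean P (F u)) g s xi.
  move=> tp; rewrite (funext (fun w => E s xi (F^~ w))) E.
  have [|_ ->//] := @mean_sum _ _ _ P _ (index_iota 0 (size s))
    (fun n => g (nth t (a :: s) n.+1) - g (nth t (a :: s) n)) (fun n => F (xi n)).
  by move=> n /(inat _ _ _ _ tp) /FM; exact: sq_bounded_integrable.
have lim (s : nat -> seq R) (xi : nat -> nat -> R) :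
    (forall n, tagged_partition a t (n.+1%:R^-1) (s n) (xi n)) ->
    forall w, (fun n => RSsum a t (F^~ w) g (s n) (xi n)) @ \oo -->
      RS_integral a t (F^~ w) g.
  move=> tp w; apply/cvgrPdist_lt => e e0.
  have /is_RS_integralP/(_ e e0)[r r0 H] := RS_integralP ab ug bv (uF w) tab.
  near=> n; rewrite distrC; apply: H; have [p m x] := tp n; split => // i /m mi.
  apply: lt_trans mi _.
  by near: n; exact: near_infty_natSinv_lt (PosNum r0).
have tagged n : exists sx : seq R * (nat -> R), tagged_partition a t (n.+1%:R^-1) sx.1 sx.2.
  have n0 : 0 < n.+1%:R^-1 :> R by rewrite invr_gt0.
  by have [s [xi tp]] := exists_tagged_partition at_ n0; exists (s, xi).
have [sx tp] := choice tagged.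
split.
  by apply: sq_bounded_lim (lim _ _ tp) => n; exact: SL2 (tp n).
apply/is_RS_integralP => e e0; apply: contrapT => nd.
have bad n : exists sx : seq R * (nat -> R), tagged_partition a t (n.+1%:R^-1) sx.1 sx.2 /\
   e <= `|RSsum a t (fun u => mean P (F u)) g sx.1 sx.2 -
          mean P (fun w => RS_integral a t (F^~ w) g)|.
  have n0 : 0 < n.+1%:R^-1 :> R by rewrite invr_gt0.
  apply: contrapT => K; apply: nd; exists n.+1%:R^-1 => // s xi tps.
  by rewrite ltNge; apply/negP => H; apply: K; exists (s, xi).
have [sx' tp'] := choice bad.
have tp1 n := (tp' n).1.
have := mean_cvg (fun n => SL2 _ _ _ (tp1 n)) (lim _ _ tp1).
move=> /cvgrPdist_lt/(_ e e0) [N _ /(_ N (leqnn N))] /=.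
rewrite (ExS _ _ _ (tp1 N)) distrC ltNge; have [_ ->//] := tp' N.
Unshelve. all: by end_near. Qed.

End ExpectedStieltjes.

Section Simplex.
Variable R : realType.

Lemma big_ord_lift (V : Type) (idx : V) (op : Monoid.law idx) k (F : 'I_k.+1 -> V) :
  \big[op/idx]_(j < k.+1) F j = op (\big[op/idx]_(j < k) F (lift ord_max j)) (F ord_max).
Proof.
rewrite big_ord_recr; congr (op _ _); apply: eq_bigr => j _; congr F.
by apply/val_inj/esym; exact: lift_max.
Qed.

Lemma row_rcons_max k (v : 'rV[R]_k) u : row_rcons v u 0 ord_max = u.
Proof. by rewrite mxE unlift_none. Qed.

Lemma row_rcons_lift k (v : 'rV[R]_k) u j : row_rcons v u 0 (lift ord_max j) = v 0 j.
Proof. by rewrite mxE liftK. Qed.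

Lemma closed_simplex_rcons k (s t u : R) (v : 'rV[R]_k) : s <= u <= t ->
  closed_simplex s u v -> closed_simplex s t (row_rcons v u).
Proof.
move=> /andP[su ut] [v1 v2]; split=> [j|i j].
  case: (unliftP ord_max j) => [j' ->|->].
    by rewrite row_rcons_lift; have /andP[-> /le_trans->] := v1 j'.
  by rewrite row_rcons_max su.
case: (unliftP ord_max i) => [i' ->|->]; case: (unliftP ord_max j) => [j' ->|->].
- by rewrite !row_rcons_lift !lift_max; exact: v2.
- by rewrite row_rcons_lift row_rcons_max; have /andP[] := v1 i'.
- by rewrite lift_max /= leqNgt ltn_ord.
- by rewrite row_rcons_max.
Qed.

Lemma simplex_integralZ k (s t c : R) (f : 'rV[R]_k -> R) (g : 'I_k -> R -> R) : s <= t ->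
  simplex_integral s t (fun v => c * f v) g = c * simplex_integral s t f g.
Proof.
elim: k t f g => [//|k IH] t f g st /=.
rewrite -RS_integralZ//; apply: RS_integral_eqf => u /andP[su _].
exact: IH.
Qed.

(** For a product the inner integral factors out of the integrand, and the iterated
    integral becomes a nested one-dimensional recursion. *)
Lemma simplex_integral_prodS k (s t : R) (h : 'I_k.+1 -> R -> R) (g : 'I_k.+1 -> R -> R) :
  simplex_integral s t (fun v => \prod_j h j (v 0 j)) g =
  RS_integral s t (fun u => h ord_max u *
    simplex_integral s u (fun v => \prod_j h (lift ord_max j) (v 0 j))
      (fun j => g (lift ord_max j))) (g ord_max).
Proof.
rewrite /=; apply: RS_integral_eqf => u /andP[su _].
rewrite -simplex_integralZ//; congr (simplex_integral _ _ _ _); apply/funext => v.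
rewrite big_ord_lift row_rcons_max mulrC; congr (_ * _).
by apply: eq_bigr => j _; rewrite row_rcons_lift.
Qed.

Lemma simplex_integral_ucont k (a b : R) (h : 'I_k -> R -> R) (g : 'I_k -> R -> R) : a < b ->
  (forall j, ucont a b (h j)) -> (forall j, ucont a b (g j)) ->
  (forall j, bounded_variation a b (g j)) ->
  ucont a b (fun t => simplex_integral a t (fun v => \prod_j h j (v 0 j)) g).
Proof.
move=> ab; elim: k h g => [|k IH] h g uh ug bg.
  rewrite /=; exact: ucont_cst.
rewrite (funext (fun t => simplex_integral_prodS a t h g)).
apply: RS_integral_ucont => //; apply: ucontM => //.
exact: (IH (fun j => h (lift ord_max j)) (fun j => g (lift ord_max j))).

Qed.

End Simplex.

Section ExpectedSimplex.
Context {d : measure_display} {Omega : measurableType d} {R : realType}.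
Variable P : probability Omega R.

(** The random factor Z is what makes the induction on k work: for a fixed value u
    of the outermost variable, h ord_max u joins Z and the remaining integral over
    the simplex below u is of the same form. *)
Lemma mean_simplex_integral k (a b : R) (h : 'I_k -> R -> Omega -> R) (g : 'I_k -> R -> R)
    (Z : Omega -> R) M t : a < b ->
  (forall j w, ucont a b ((h j)^~ w)) -> (forall j, ucont a b (g j)) ->
  (forall j, bounded_variation a b (g j)) -> a <= t <= b ->
  (forall v, closed_simplex a t v -> sq_bounded P M (fun w => Z w * \prod_j h j (v 0 j) w)) ->
  sq_bounded P ((\prod_j total_var a b (g j) ^+ 2) * M)
    (fun w => Z w * simplex_integral a t (fun v => \prod_j h j (v 0 j) w) g) /\
  mean P (fun w => Z w * simplex_integral a t (fun v => \prod_j h j (v 0 j) w) g) =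
  simplex_integral a t (fun v => mean P (fun w => Z w * \prod_j h j (v 0 j) w)) g.
Proof.
move=> ab; elim: k h g Z t => [|k IH] h g Z t uh ug bg tab HM.
  rewrite big_ord0 mul1r /=.
  by split => //; apply: HM; split => -[].
pose h' j := h (lift ord_max j); pose g' j := g (lift ord_max j).
pose F u w := Z w * h ord_max u w *
  simplex_integral a u (fun v => \prod_j h' j (v 0 j) w) g'.
have HF u : a <= u <= t -> sq_bounded P ((\prod_j total_var a b (g' j) ^+ 2) * M) (F u) /\
    mean P (F u) = simplex_integral a u (fun v => mean P (fun w =>
      Z w * h ord_max u w * \prod_j h' j (v 0 j) w)) g'.
  move=> /[dup] uat /andP[au ut]; apply: (IH h' g' (fun w => Z w * h ord_max u w) u).
  - by move=> j w; exact: uh.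
  - by move=> j; exact: ug.
  - by move=> j; exact: bg.
  - by rewrite au (le_trans ut)//; case/andP: tab.
  move=> v /(closed_simplex_rcons uat)/HM [mH HH].
  suff E : (fun w => Z w * \prod_j h j (row_rcons v u 0 j) w) =
    (fun w => Z w * h ord_max u w * \prod_j h' j (v 0 j) w) by rewrite -E.
  apply/funext => w; rewrite big_ord_lift row_rcons_max -mulrA; congr (_ * _).
  by rewrite mulrC; congr (_ * _); apply: eq_bigr => j _; rewrite row_rcons_lift.
have uF w : ucont a b (F^~ w).
  apply: ucontM; first by apply: ucontM => //; exact: ucont_cst.
  by apply: (@simplex_integral_ucont _ _ _ _ (fun j u => h' j u w) g') => // j;
    rewrite /h' /g'.
have [L2 isE] := mean_RS_integral ab (ug ord_max) (bg ord_max) tab uF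
  (fun u uu => (HF u uu).1).
have at_ : a <= t by case/andP: tab.
have E : (fun w => Z w * simplex_integral a t (fun v => \prod_j h j (v 0 j) w) g) =
   (fun w => RS_integral a t (F^~ w) (g ord_max)).
  apply/funext => w; rewrite (simplex_integral_prodS a t (fun j u => h j u w)) -RS_integralZ//.
  by apply: RS_integral_eqf => u _; rewrite /F mulrA.
rewrite E; split.
  have -> : (\prod_j total_var a b (g j) ^+ 2) * M =
      total_var a b (g ord_max) ^+ 2 * (\prod_j total_var a b (g' j) ^+ 2 * M).
    by rewrite big_ord_lift [X in X * M]mulrC -mulrA.
  exact: L2.
rewrite -(RS_integral_eq at_ isE) /=; apply: RS_integral_eqf => u uat.
rewrite (HF u uat).2; congr (simplex_integral _ _ _ _); apply/funext => v.
congr (mean P _); apply/funext => w; rewrite big_ord_lift row_rcons_max -mulrA; congr (_ * _).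
by rewrite mulrC; congr (_ * _); apply: eq_bigr => j _; rewrite row_rcons_lift.
Qed.

End ExpectedSimplex.

(** * The partially commutative signature *)

Section Blocks.
Variables A' A'' : finType.
Notation W := (word A' A'').

(** The recursion that splits off the last letter of A' and the last block. *)
Lemma block_wordS k (w : 'I_k.+2 -> seq A'') (i : 'I_k.+1 -> A') :
  block_word w i = block_word (fun j => w (lift ord_max j)) (fun j => i (lift ord_max j))
    ++ inl (i ord_max) :: map inr (w ord_max).
Proof.
rewrite /block_word /image_mem enum_ordSr map_rcons flatten_rcons -map_comp -!catA.
rewrite cat_rcons; congr (flatten _ ++ _); apply: eq_map => j /=.
by have -> : widen_ord (leqnSn k) j = lift ord_max j by apply/val_inj/esym; exact: lift_max.
Qed.

Lemma block_word0 (w : 'I_1 -> seq A'') (i : 'I_0 -> A') :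
  block_word w i = map inr (w ord_max) :> W.
Proof. by rewrite /block_word /image_mem (size0nil (size_enum_ord 0)). Qed.

Lemma exists_block_word (v : W) :
  exists k (w : 'I_k.+1 -> seq A'') (i : 'I_k -> A'), v = block_word w i.
Proof.
elim/last_ind: v => [|v x [k [w [i ->]]]].
  have i0 : 'I_0 -> A' by case.
  by exists 0%N, (fun=> [::]), i0; rewrite block_word0.
case: x => [l|j].
  exists k.+1, (fun j => oapp w [::] (unlift ord_max j)),
    (fun j => oapp i l (unlift ord_max j)).
  rewrite block_wordS !unlift_none /= cats1; congr (rcons _ _).
  congr (block_word _ _); apply/funext => j; by rewrite liftK.
exists k, (fun m => oapp (fun m' => w (lift ord_max m')) (rcons (w ord_max) j)
  (unlift ord_max m)), i.
rewrite /block_word unlift_none /= map_rcons -rcons_cat; congr (rcons (flatten _ ++ _) _).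
by apply: eq_map => m; rewrite liftK.
Qed.

End Blocks.

Section CompactSimplex.
Variable R : realType.

Lemma compact_closed_simplex k (s t : R) : compact (@closed_simplex R s t k).
Proof.
have cproj (i : 'I_k) : continuous (fun v : 'rV[R]_k => v 0 i) by exact: coord_continuous.
apply: (@subclosed_compact _ _ [set v : 'rV[R]_k | forall i, `[s, t]%classic (v ord0 i)]).
- have -> : @closed_simplex R s t k =
      (\bigcap_i (fun v : 'rV[R]_k => v 0 i) @^-1` `[s, t]%classic) `&`
      \bigcap_(p in [set p : 'I_k * 'I_k | (p.1 <= p.2)%N])
         (fun v : 'rV[R]_k => v 0 p.2 - v 0 p.1) @^-1` [set x | 0 <= x].
    apply/seteqP; split => v.
      move=> [v1 v2]; split => [i _|p /= p12]; first by rewrite /= in_itv /= v1.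
      by rewrite subr_ge0 v2.
    move=> [v1 v2]; split => [j|i j ij]; first by have := v1 j I; rewrite /= in_itv.
    by have := v2 (i, j) ij; rewrite /= subr_ge0.
  apply: closedI; apply: closed_bigI => p _; apply: preimage_closed.
  + by move=> v _; exact: cproj.
  + exact: interval_closed.
  + by move=> v _; exact: (cvgB (cproj p.2 v) (cproj p.1 v)).
  + exact: closed_ge.
- exact: (@rV_compact R k (fun=> `[s, t]%classic) (fun=> @segment_compact R s t)).
- by move=> v [v1 _] i; rewrite /= in_itv /= v1.
Qed.

Lemma continuous_closed_simplex_bounded k (s t : R) (f : 'rV[R]_k -> R) :
  {within @closed_simplex R s t k, continuous f} ->
  exists B, forall v, closed_simplex s t v -> `|f v| <= B.
Proof.
move=> cf; have := compact_bounded (continuous_compact cf (@compact_closed_simplex k s t)).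
move=> [M [_ H]]; exists (`|M| + 1) => v vs; apply: (H (`|M| + 1)).
  by rewrite (le_lt_trans (ler_norm M))// ltrDl.
by exists v.
Qed.

End CompactSimplex.

Section WordFunction.
Variables (R : realType) (A' A'' : finType).
Variables (a : A' -> R -> R) (x : A'' -> R -> R).
Notation W := (word A' A'').

Definition divpow (v : seq A'') (t : R) : R := incr_pow x 0 t v / (pcfact v)%:R.

Lemma divpow_perm v v' : perm_eq v v' -> divpow v =1 divpow v'.
Proof.
move=> /permP vv' t; rewrite /divpow /incr_pow /pcfact; congr (_ / _%:R).
  by apply: eq_bigr => i _; rewrite vv'.
by apply: eq_bigr => i _; rewrite vv'.
Qed.

(** The right-hand side of the definition of the signature, as a function of the
    reversed word; b is the part of the last block that has been read. *)
Fixpoint word_integral (r : W) (b : seq A'') (t : R) : R :=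
  match r with
  | [::] => divpow b t
  | inr j :: r' => word_integral r' (j :: b) t
  | inl i :: r' => divpow b t * RS_integral 0 t (word_integral r' [::]) (a i)
  end.

Lemma word_integral_perm r b b' t :
  perm_eq b b' -> word_integral r b t = word_integral r b' t.
Proof.
elim: r b b' => [|[i|j] r IH] b b' bb' /=; first exact: divpow_perm.
  by rewrite (divpow_perm bb').
by apply: IH; rewrite perm_cons.
Qed.

(** The blocks enter through their letter multiplicities only. *)
Lemma word_integral_swapinv b t : swapinv (fun r => word_integral r b t).
Proof.
move=> u y z v; elim: u b t => [|[i|j] u IH] b t /=.
- apply: word_integral_perm; apply/permP => p /=; by rewrite addnCA.
- congr (_ * RS_integral _ _ _ _); apply/funext => s; exact: IH.
- exact: IH.
Qed.

Lemma word_integral_cat c r b t :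
  word_integral (map inr c ++ r) b t = word_integral r (rev c ++ b) t.
Proof. by elim: c b => [//|j c IH] b /=; rewrite IH rev_cons cat_rcons. Qed.

Lemma word_integral_block k (w : 'I_k.+1 -> seq A'') (i : 'I_k -> A') t : 0 <= t ->
  word_integral (rev (block_word w i)) [::] t = divpow (w ord_max) t *
  simplex_integral 0 t (fun u => \prod_j divpow (w (lift ord_max j)) (u 0 j))
    (fun j => a (i j)).
Proof.
elim: k w i t => [|k IH] w i t t0.
  rewrite block_word0 -map_rev -[map _ _]cats0 word_integral_cat revK cats0 /=.
  by rewrite big_ord0 mulr1.
rewrite block_wordS rev_cat rev_cons -map_rev cat_rcons word_integral_cat revK cats0.
rewrite [word_integral _ _ _]/=; congr (_ * _).
apply: etrans (esym (simplex_integral_prodS 0 t (fun j => divpow (w (lift ord_max j)))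
  (fun j => a (i j)))).
by apply: RS_integral_eqf => u /andP[u0 _]; exact: IH.
Qed.

Definition class_integral (c : pcword R A' A'') (t : R) : R :=
  word_integral (rev (repr c)) [::] t.

Lemma class_integral_pcl v t : class_integral (pcl R v) t = word_integral (rev v) [::] t.
Proof.
rewrite /class_integral.
apply: (pcl_invariant (h := fun v => word_integral (rev v) [::] t) _
  (pcl_repr (pcl R v))).
exact: (swapinv_rev (@word_integral_swapinv [::] t)).
Qed.

(** The defining equations are indexed by words, but their right-hand sides agree
    on words with the same class; so they are equations for [hatPsi], which is
    onto. *)
Lemma hatSigP t : 0 <= t -> is_hatSig a x 0 t (hatSig a x 0 t).
Proof.
move=> t0; rewrite /hatSig; case: xgetP => [S _ //|nex].
have [S SJ] := hatPsi_surj (fun c => class_integral c t); exfalso; apply: (nex S) => k w i.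
by rewrite SJ class_integral_pcl word_integral_block.
Qed.

Lemma hatPsi_hatSig t c : 0 <= t -> hatPsi (hatSig a x 0 t) c = class_integral c t.
Proof.
move=> t0; rewrite -(pcl_repr c); have [k [w [i ->]]] := exists_block_word (repr c).
by rewrite (hatSigP t0 w i) class_integral_pcl word_integral_block.
Qed.

End WordFunction.

Section Correlators.
Context {d : measure_display} {Omega : measurableType d} {R : realType}.
Variables (P : probability Omega R) (A' A'' : finType) (T : R) (hT : 0 < T).
Variable X : A'' -> R -> {RV P >-> R}.
Hypothesis hX : forall i omega, {within `[0, T], continuous (fun t => X i t omega)}.
Hypothesis hfin : forall k (w : 'I_k.+1 -> seq A'') (t : 'rV[R]_k),
    closed_simplex 0 T t ->
    P.-integrable [set: Omega] (EFin \o corr_rv X T w t).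
Hypothesis hcont : forall k (w : 'I_k.+1 -> seq A''),
    {within @closed_simplex R 0 T k, continuous (correlator P X T w)}.

Notation Xw omega := (fun i u => X i u omega).

Lemma corr_rvE k (w : 'I_k.+1 -> seq A'') (t : 'rV[R]_k) omega :
  corr_rv X T w t omega = divpow (Xw omega) (w ord_max) T *
    \prod_j divpow (Xw omega) (w (lift ord_max j)) (t 0 j).
Proof.
rewrite /corr_rv big_ord_lift [LHS]mulrC row_rcons_max; congr (_ * _).
by apply: eq_bigr => j _; rewrite row_rcons_lift.
Qed.

Lemma measurable_divpow v t : measurable_fun [set: Omega] (fun omega => divpow (Xw omega) v t).
Proof.
apply: measurable_funM; last exact: measurable_cst.
apply: measurable_prodr => i; apply: measurable_funX; apply: measurable_funB => //.
Qed.

Lemma measurable_corr_rv k (w : 'I_k.+1 -> seq A'') (t : 'rV[R]_k) :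
  measurable_fun [set: Omega] (corr_rv X T w t).
Proof.
rewrite (funext (corr_rvE w t)); apply: measurable_funM; first exact: measurable_divpow.
by apply: measurable_prodr => j; exact: measurable_divpow.
Qed.

Lemma divpow_ucont omega v : ucont 0 T (divpow (Xw omega) v).
Proof.
apply: ucontM; last exact: ucont_cst.
apply: ucont_prod => i; apply: ucontX; apply: ucontB; last exact: ucont_cst.
exact/ucontP.
Qed.

Lemma pcfact_gt0 (v : seq A'') : (0 < pcfact v)%N.
Proof. by apply: prodn_gt0 => i; exact: fact_gt0. Qed.

(** The constant that relates the square of a divided power to the divided power
    of the doubled block. *)
Definition sqr_cst (v : seq A'') : R := (pcfact (v ++ v))%:R / (pcfact v)%:R ^+ 2.

Lemma sqr_divpow x v (t : R) : divpow x v t ^+ 2 = sqr_cst v * divpow x (v ++ v) t.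
Proof.
have f1 : (pcfact v)%:R != 0 :> R by rewrite pnatr_eq0 -lt0n pcfact_gt0.
have f2 : (pcfact (v ++ v))%:R != 0 :> R by rewrite pnatr_eq0 -lt0n pcfact_gt0.
have -> : divpow x v t ^+ 2 = incr_pow x 0 t (v ++ v) / (pcfact v)%:R ^+ 2.
  rewrite /divpow expr_div_n; congr (_ / _).
  rewrite /incr_pow expr2 -big_split; apply: eq_bigr => i _.
  by rewrite count_cat exprD.
rewrite /sqr_cst /divpow; field.
by rewrite f1 f2.
Qed.

Lemma sqr_corr_rv k (w : 'I_k.+1 -> seq A'') (t : 'rV[R]_k) omega :
  corr_rv X T w t omega ^+ 2 =
  (\prod_j sqr_cst (w j)) * corr_rv X T (fun j => w j ++ w j) t omega.
Proof.
rewrite !corr_rvE exprMn sqr_divpow big_ord_lift /= -prodrXl.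
under eq_bigr => j _ do rewrite sqr_divpow.
by rewrite big_split /=; ring.
Qed.

(** The mean of the square is a multiple of the correlator of the doubled blocks,
    which is continuous on a compact set. *)
Lemma corr_rv_sq_bounded k (w : 'I_k.+1 -> seq A'') : exists M, forall t : 'rV[R]_k,
  closed_simplex 0 T t -> sq_bounded P M (corr_rv X T w t).
Proof.
have cw : {within @closed_simplex R 0 T k,
    continuous (correlator P X T (fun j => w j ++ w j))} by exact: hcont.
have [B HB] := continuous_closed_simplex_bounded cw.
exists ((\prod_j sqr_cst (w j)) * B) => t ts; split; first exact: measurable_corr_rv.
have K0 : 0 <= \prod_j sqr_cst (w j).
  by apply: prodr_ge0 => j _; rewrite divr_ge0 ?exprn_ge0.
have iw := hfin (fun j => w j ++ w j) ts.
have E omega : (corr_rv X T w t omega ^+ 2)%:E =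
    ((\prod_j sqr_cst (w j))%:E * (corr_rv X T (fun j => w j ++ w j) t omega)%:E)%E.
  by rewrite sqr_corr_rv EFinM.
under eq_integral => omega _ do rewrite E.
rewrite integralZl// EFinM lee_wpmul2l ?lee_fin//.
have := HB t ts; rewrite /correlator unlock => Bt.
rewrite -(@fineK _ (\int[P]_x _)%E); last exact: integrable_fin_num.
by rewrite lee_fin; exact: le_trans (ler_norm _) Bt.
Qed.

Variable A : A' -> R -> R.
Hypothesis hAcont : forall i, {within `[0, T], continuous (A i)}.
Hypothesis hABV : forall i, bounded_variation 0 T (A i).

Lemma mean_word_integral k (w : 'I_k.+1 -> seq A'') (i : 'I_k -> A') :
  (exists M, sq_bounded P M
    (fun omega => class_integral A (Xw omega) (pcl R (block_word w i)) T)) /\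
  mean P (fun omega => class_integral A (Xw omega) (pcl R (block_word w i)) T) =
  simplex_integral 0 T (correlator P X T w) (fun j => A (i j)).
Proof.
have [M HM] := corr_rv_sq_bounded w.
have uA j : ucont 0 T (A j) by exact/ucontP.
have [] := @mean_simplex_integral _ _ _ P k 0 T
  (fun j u omega => divpow (Xw omega) (w (lift ord_max j)) u) (fun j => A (i j))
  (fun omega => divpow (Xw omega) (w ord_max) T) M T hT _ _ _ _ _.
- by move=> j omega; exact: divpow_ucont.
- by move=> j; exact: uA.
- by move=> j; exact: hABV.
- by rewrite lexx ltW.
- by move=> v /HM; rewrite (funext (corr_rvE w v)).
have E omega : divpow (Xw omega) (w ord_max) T *
    simplex_integral 0 T (fun v => \prod_j divpow (Xw omega) (w (lift ord_max j)) (v 0 j))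
      (fun j => A (i j)) = class_integral A (Xw omega) (pcl R (block_word w i)) T.
  by rewrite class_integral_pcl word_integral_block ?ltW.
rewrite (funext E) => L2 ->; split; first by eexists; exact: L2.
congr (simplex_integral _ _ _ _); apply/funext => v.
transitivity (mean P (corr_rv X T w v)); first by rewrite (funext (corr_rvE w v)).
by rewrite /correlator unlock.
Qed.

Lemma class_integral_integrable c : P.-integrable [set: Omega]
  (EFin \o (fun omega => class_integral A (Xw omega) c T)).
Proof.
rewrite -(pcl_repr c); have [k [w [i ->]]] := exists_block_word (repr c).
have [[M HM] _] := mean_word_integral w i; exact: sq_bounded_integrable HM.
Qed.

(** By the triangular system, a coordinate of the signature is an integrable
    variable minus a finite combination of coordinates of larger weight. *)
Lemma hatSig_integrable (c : pcword R A' A'') :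
  P.-integrable [set: Omega] (EFin \o hatSig_rv X A T c).
Proof.
elim/cweight_ind: c => c IH.
pose s := [seq u <- words (A' + A'')%type (csize c) |
  canonical_word R u && (cweight c < weight (rev u))%N].
have E omega : hatSig_rv X A T c omega = class_integral A (Xw omega) c T -
    \sum_(u <- s) hatPsi_coef c u * hatSig_rv X A T (pcl R u) omega.
  rewrite /hatSig_rv -(hatPsi_hatSig _ _ c (ltW hT)) hatPsi_triangular /s big_filter.
  by rewrite addrK.
have [|iS _] := @mean_sum _ _ _ P _ s (hatPsi_coef c)
  (fun u => hatSig_rv X A T (pcl R u)).
  move=> u; rewrite mem_filter mem_words => /andP[/andP[_ lt] /eqP un].
  by apply: IH; rewrite ?csize_pcl ?cweight_pcl.
rewrite (funext E); exact: (integrableB measurableT (class_integral_integrable c) iS).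
Qed.

Lemma hatPsi_expected_hatSig (c : pcword R A' A'') :
  hatPsi (expected_hatSig P X A T) c = mean P (fun omega => class_integral A (Xw omega) c T).
Proof.
have EE c' : expected_hatSig P X A T c' = mean P (hatSig_rv X A T c').
  by rewrite /expected_hatSig unlock.
pose s := [seq u <- words (A' + A'')%type (csize c) |
  canonical_word R u && (cweight c < weight (rev u))%N].
have E omega : class_integral A (Xw omega) c T = hatSig_rv X A T c omega +
    \sum_(u <- s) hatPsi_coef c u * hatSig_rv X A T (pcl R u) omega.
  by rewrite /hatSig_rv -(hatPsi_hatSig _ _ c (ltW hT)) hatPsi_triangular /s big_filter.
have [|iS ES] := @mean_sum _ _ _ P _ s (hatPsi_coef c)
  (fun u => hatSig_rv X A T (pcl R u)).
  by move=> u _; exact: hatSig_integrable.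
rewrite (funext E) hatPsi_triangular EE /mean RintegralD//; last exact: hatSig_integrable.
congr (_ + _); rewrite -/(mean P _) ES /s big_filter.
by apply: eq_bigr => u _; rewrite EE.
Qed.

End Correlators.

Theorem corollary1p4 (R : realType) (d : measure_display)
  (Omega : measurableType d) (P : probability Omega R)
  (A' A'' : finType) (hA' : (0 < #|A'|)%N) (hA'' : (0 < #|A''|)%N)
  (T : R) (hT : 0 < T)
  (X : A'' -> R -> {RV P >-> R})
  (hX : forall i omega, {within `[0, T], continuous (fun t => X i t omega)})
  (A : A' -> R -> R)
  (hAcont : forall i, {within `[0, T], continuous (A i)})
  (hABV : forall i, bounded_variation 0 T (A i))
  (hfin : forall k (w : 'I_k.+1 -> seq A'') (t : 'rV[R]_k),
    closed_simplex 0 T t ->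
    P.-integrable [set: Omega] (EFin \o corr_rv X T w t))
  (hcont : forall k (w : 'I_k.+1 -> seq A''),
    {within @closed_simplex R 0 T k, continuous (correlator P X T w)}) :
  (forall c : pcword R A' A'',
    P.-integrable [set: Omega] (EFin \o hatSig_rv X A T c)) /\
  (forall k (w : 'I_k.+1 -> seq A'') (i : 'I_k -> A'),
    hatPsi (expected_hatSig P X A T) (pcl R (block_word w i)) =
    simplex_integral 0 T (correlator P X T w) (fun j => A (i j))).
Proof.
split=> [c|k w i]; first exact: hatSig_integrable.
rewrite hatPsi_expected_hatSig//.
by have [_ ->] := mean_word_integral hT hX hfin hcont hAcont hABV w i.
Qed.
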